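(* Let $k \ge 1$ and $\theta = 2\pi/(4k+3)$. For every $\varepsilon > 0$ there exist a finite point set $P$ in general position and $u, w \in P$ such that the shortest path between $u$ and $w$ in the $\theta_{4k+3}$-graph on $P$ has length at least $(L - \varepsilon)|uw|$, where $$L = \frac{3\cos(\theta/4) + \cos(3\theta/4) + \sin(\theta/2) + \sin\theta + \sin(3\theta/2)}{3\cos(\theta/2) + \cos(3\theta/2)}.$$ That is, the worst-case spanning ratio of $\theta_{4k+3}$-graphs is at least $L$.
   Context: Cones: for $m \ge 2$, $\theta = 2\pi/m$; around each point $u$ draw $m$ rays with consecutive angular separation $\theta$, oriented so the vertical upward ray from $u$ bisects a cone $C_0^u$; cones numbered clockwise, same orientation at every point. General position: no two points on a line parallel to a cone boundary ray, no two on a line perpendicular to a cone bisector, no three collinear. The $\theta_m$-graph on $P$: for each $u\in P$ and each cone $C_i^u$ containing another point of $P$, add an edge from $u$ to the point of $C_i^u$ whose orthogonal projection onto the bisector of $C_i^u$ is closest to $u$; edges weighted by Euclidean length. *)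

(* Defs.v *)
From Stdlib Require Import Reals Lra List.
Import ListNotations.
Open Scope R_scope.

Definition pt := (R * R)%type.

Definition vsub (p q : pt) : pt := (fst p - fst q, snd p - snd q).
Definition dot (p q : pt) : R := fst p * fst q + snd p * snd q.
Definition cross (p q : pt) : R := fst p * snd q - snd p * fst q.
Definition edist (p q : pt) : R :=
  sqrt ((fst p - fst q) ^ 2 + (snd p - snd q) ^ 2).

Definition cone_angle (m : nat) : R := 2 * PI / INR m.

(* unit vector along the bisector of cone C_i: cone C_0 is bisected by the
   upward vertical ray, cones are numbered clockwise *)
Definition bisector (m i : nat) : pt :=
  (cos (PI / 2 - INR i * cone_angle m), sin (PI / 2 - INR i * cone_angle m)).

(* unit vector along the boundary ray between cones C_(i-1) and C_i
   (counterclockwise boundary of C_i); i < m enumerates all boundary rays *)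
Definition boundary_ray (m i : nat) : pt :=
  (cos (PI / 2 - INR i * cone_angle m + cone_angle m / 2),
   sin (PI / 2 - INR i * cone_angle m + cone_angle m / 2)).

(* v lies in the cone C_i^u: the angle between v - u and the bisector is at
   most theta/2 (closed cone; boundaries are excluded by general position) *)
Definition in_cone (m i : nat) (u v : pt) : Prop :=
  v <> u /\ dot (vsub v u) (bisector m i) >= edist v u * cos (cone_angle m / 2).

Definition general_position (m : nat) (P : list pt) : Prop :=
  NoDup P /\
  (forall u v, In u P -> In v P -> u <> v ->
     (forall j, (j < m)%nat -> cross (vsub v u) (boundary_ray m j) <> 0) /\
     (forall i, (i < m)%nat -> dot (vsub v u) (bisector m i) <> 0)) /\
  (forall u v w, In u P -> In v P -> In w P -> u <> v -> u <> w -> v <> w ->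
     cross (vsub v u) (vsub w u) <> 0).

Definition theta_dedge (m : nat) (P : list pt) (u v : pt) : Prop :=
  In u P /\ In v P /\
  exists i, (i < m)%nat /\ in_cone m i u v /\
    forall w, In w P -> in_cone m i u w ->
      dot (vsub v u) (bisector m i) <= dot (vsub w u) (bisector m i).

Definition theta_edge (m : nat) (P : list pt) (u v : pt) : Prop :=
  theta_dedge m P u v \/ theta_dedge m P v u.

Fixpoint walk (E : pt -> pt -> Prop) (u : pt) (l : list pt) (w : pt) : Prop :=
  match l with
  | [] => u = w
  | x :: l' => E u x /\ walk E x l' w
  end.

Fixpoint walk_len (u : pt) (l : list pt) : R :=
  match l with
  | [] => 0
  | x :: l' => edist u x + walk_len x l'
  end.

Definition lower_bound_L (th : R) : R :=
  (3 * cos (th / 4) + cos (3 * th / 4) + sin (th / 2) + sin th + sin (3 * th / 2))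
  / (3 * cos (th / 2) + cos (3 * th / 2)).

(* Main.v *)
Require Import Defs.
From Stdlib Require Import Reals Lra Lia List ZArith Bool Classical.
Import ListNotations.
Open Scope R_scope.

(* Write [phi = theta / 4].  The point [w] lies at angle [phi] from the bisector of a cone of [u].
   A point [v1] in the far corner of the canonical triangle of [u w] destroys the edge from [u]
   to [w]; a point [v2] in a corner of the triangle of [w v1] destroys the edge from [w] to [v1];
   a third point destroys the edge from [v1] to [v2].  Every edge has to be destroyed in both
   directions and the picture is symmetric in the perpendicular bisector of [u w], which gives 16
   points.  For [theta <= 2 PI / 11] the blocker of the edge from [v2] to [v1] lies in a cone of
   [u] that would otherwise contain no closer point, and would be a shortcut; one more point per
   side (the last of [half_nodes]) prevents this.

   In the limit position the corners tie with the edges they should destroy, so each point [p]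
   moves to [p + delta * d] with [d] chosen to break all ties, and then a little further into
   general position.

   The length of paths is bounded below by a potential: two points either are at least as far
   apart as their potentials differ, or both directed edges between them are destroyed by a third
   point.  Tested against unit vectors at multiples of [phi], all these conditions are linear in
   the coordinates, and they become sign conditions on integer polynomials in
   [t = 17 / 2 * tan (phi / 2)], which lies in (0, 1] as soon as [theta <= 2 PI / 7]. *)

(** * Signs of integer polynomials on (0, 1] *)

Fixpoint padd (p q : list Z) : list Z :=
  match p, q with
  | [], _ => q
  | _, [] => p
  | a :: p', b :: q' => (a + b)%Z :: padd p' q'
  end.

Definition pscale (a : Z) (p : list Z) : list Z := map (Z.mul a) p.

Fixpoint pmul (p q : list Z) : list Z :=
  match p with
  | [] => []
  | a :: p' => padd (pscale a q) (0%Z :: pmul p' q)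
  end.

Fixpoint peval (p : list Z) (t : R) : R :=
  match p with
  | [] => 0
  | a :: p' => IZR a + t * peval p' t
  end.

Lemma peval_add p q t : peval (padd p q) t = peval p t + peval q t.
Proof.
  revert q; induction p as [|a p IH]; intros [|b q]; simpl; try lra.
  rewrite IH, plus_IZR; ring.
Qed.

Lemma peval_scale a p t : peval (pscale a p) t = IZR a * peval p t.
Proof.
  unfold pscale; induction p as [|b p IH]; simpl; [ring|].
  rewrite IH, mult_IZR; ring.
Qed.

Lemma peval_mul p q t : peval (pmul p q) t = peval p t * peval q t.
Proof.
  induction p as [|a p IH]; simpl; [ring|].
  rewrite peval_add, peval_scale; simpl; rewrite IH; ring.
Qed.

(** Horner form: if [q >= c] and [0 <= t <= 1], then [t * q >= min 0 c]. *)
Fixpoint lower_bound01 (p : list Z) : Z :=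
  match p with
  | [] => 0
  | a :: p' => a + Z.min 0 (lower_bound01 p')
  end.

Lemma lower_bound01_le p t : 0 <= t <= 1 -> IZR (lower_bound01 p) <= peval p t.
Proof.
  intros Ht; induction p as [|a p IH]; [simpl; lra|].
  cbn [lower_bound01 peval]; rewrite plus_IZR.
  destruct (Z.min_spec 0 (lower_bound01 p)) as [[H ->]|[H ->]].
  - apply IZR_lt in H; nra.
  - apply IZR_le in H; nra.
Qed.

(** Horner's rule on reversed coefficients: each step replaces [acc] by [a + (1 + z) * acc]. *)
Fixpoint compose_rev (acc p : list Z) : list Z :=
  match p with
  | [] => acc
  | a :: p' => compose_rev (padd [a] (padd acc (0%Z :: acc))) p'
  end.

(* With [t = 1 / (1 + z)], [compose_rev [] p] evaluates at [z] to [(1 + z) ^ deg p * p t]. *)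
Lemma peval_compose_rev z acc p t : t * (1 + z) = 1 ->
  peval (compose_rev acc p) z * t ^ length p = peval acc z + t * peval p t.
Proof.
  intros Hz; revert acc; induction p as [|a p IH]; intros acc; simpl; [ring|].
  replace (t * t ^ length p) with (t ^ length p * t) by ring.
  rewrite <- Rmult_assoc.
  change (match padd acc (0%Z :: acc) with
          | [] => [a] | b :: q' => (a + b)%Z :: q' end)
    with (padd [a] (padd acc (0%Z :: acc))).
  rewrite IH, !peval_add; simpl.
  replace (peval acc z) with (t * (1 + z) * peval acc z) at 3 by (rewrite Hz; ring).
  ring.
Qed.

Definition nonneg_coeffs (p : list Z) : bool := forallb (Z.leb 0) p.

Lemma nonneg_coeffs_eval p z : nonneg_coeffs p = true -> 0 <= z -> 0 <= peval p z.
Proof.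
  intros H Hz; induction p as [|a p IH]; simpl in *; [lra|].
  apply andb_prop in H; destruct H as [Ha Hp].
  apply Z.leb_le, IZR_le in Ha; specialize (IH Hp); nra.
Qed.

Definition pos_coeffs (p : list Z) : bool :=
  match p with [] => false | a :: p' => (0 <? a)%Z && nonneg_coeffs p' end.

(** A sufficient test. Vanishing low coefficients are divided out, as [t > 0]; then either the crude
    bound is positive, or the substitution [t = 1 / (1 + z)], [z >= 0], leaves coefficients of the
    right sign. *)
Fixpoint pos01 (p : list Z) : bool :=
  match p with
  | [] => false
  | a :: p' => if (a =? 0)%Z then pos01 p'
               else (0 <? lower_bound01 p)%Z || pos_coeffs (compose_rev [] p)
  end.

Lemma pos01_sound p t : pos01 p = true -> 0 < t <= 1 -> 0 < peval p t.
Proof.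
  intros H Ht; induction p as [|a p IH]; [discriminate|].
  cbn [pos01] in H; destruct (Z.eqb_spec a 0) as [->|Ha].
  - simpl; specialize (IH H); nra.
  - apply orb_prop in H; destruct H as [H|H].
    + apply Z.ltb_lt, IZR_lt in H.
      pose proof (lower_bound01_le (a :: p) t ltac:(lra)); lra.
    + set (z := / t - 1).
      assert (Hz : t * (1 + z) = 1) by (unfold z; field; lra).
      assert (Hz0 : 0 <= z).
      { unfold z; pose proof (Rinv_le_contravar t 1 ltac:(lra) ltac:(lra)) as Hi.
        rewrite Rinv_1 in Hi; lra. }
      pose proof (peval_compose_rev z [] (a :: p) t Hz) as E.
      destruct (compose_rev [] (a :: p)) as [|b q] eqn:Eq; [discriminate|].
      simpl in H; apply andb_prop in H; destruct H as [Hb Hq].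
      apply Z.ltb_lt, IZR_lt in Hb.
      pose proof (nonneg_coeffs_eval q z Hq Hz0).
      assert (0 < peval (b :: q) z) by (simpl; nra).
      assert (0 < t ^ length (a :: p)) by (apply pow_lt; lra).
      cbn [peval] in E |- *. cbn [peval] in H0. nra.
Qed.

Definition zero_poly (p : list Z) : bool := forallb (Z.eqb 0) p.

Lemma zero_poly_sound p t : zero_poly p = true -> peval p t = 0.
Proof.
  unfold zero_poly; induction p as [|a p IH]; [reflexivity|].
  cbn [forallb peval]; intros H; apply andb_prop in H; destruct H as [Ha Hp].
  apply Z.eqb_eq in Ha; rewrite <- Ha, (IH Hp); ring.
Qed.

(** * Trigonometric polynomials *)

(* [(p, n)] stands for the rational function [p(t) / (289 + 4 t^2)^n]; it is the half-angle
   form of a trigonometric polynomial in an angle [phi] with [tan (phi / 2) = 2 t / 17]. *)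
Definition trig := (list Z * nat)%type.

Definition half_den : list Z := [289; 0; 4]%Z.

Fixpoint ppow (p : list Z) (n : nat) : list Z :=
  match n with O => [1%Z] | S n' => pmul p (ppow p n') end.

Lemma peval_pow p n t : peval (ppow p n) t = peval p t ^ n.
Proof.
  induction n as [|n IH]; simpl; [ring|].
  rewrite peval_mul, IH; reflexivity.
Qed.

(** Subtraction in [nat] truncates, so only the summand with the smaller exponent is expanded to the
    common denominator. *)
Definition tadd (a b : trig) : trig :=
  (padd (pmul (ppow half_den (snd b - snd a)) (fst a))
        (pmul (ppow half_den (snd a - snd b)) (fst b)),
   Nat.max (snd a) (snd b)).
Definition tmul (a b : trig) : trig := (pmul (fst a) (fst b), (snd a + snd b)%nat).
Definition tint (z : Z) : trig := ([z], O).
Definition topp (a : trig) : trig := (pscale (-1) (fst a), snd a).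
Definition tsub (a b : trig) : trig := tadd a (topp b).

Definition teval (t : R) (a : trig) : R := peval (fst a) t / (289 + 4 * t ^ 2) ^ snd a.

Lemma den_pos t n : 0 < (289 + 4 * t ^ 2) ^ n.
Proof. apply pow_lt; nra. Qed.

Lemma teval_add t a b : teval t (tadd a b) = teval t a + teval t b.
Proof.
  unfold teval, tadd; simpl fst; simpl snd.
  rewrite peval_add, !peval_mul, !peval_pow.
  replace (peval half_den t) with (289 + 4 * t ^ 2) by (simpl; ring).
  set (d := 289 + 4 * t ^ 2).
  assert (Hd : forall n, d ^ n <> 0) by (intro n; pose proof (den_pos t n); unfold d; lra).
  destruct (Nat.le_ge_cases (snd a) (snd b)) as [H|H].
  - rewrite (Nat.max_r _ _ H).
    replace (d ^ snd b) with (d ^ (snd b - snd a) * d ^ snd a)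
      by (rewrite <- pow_add; f_equal; lia).
    replace (snd a - snd b)%nat with O by lia; simpl; field; auto.
  - rewrite (Nat.max_l _ _ H).
    replace (d ^ snd a) with (d ^ (snd a - snd b) * d ^ snd b)
      by (rewrite <- pow_add; f_equal; lia).
    replace (snd b - snd a)%nat with O by lia; simpl; field; auto.
Qed.

Lemma teval_mul t a b : teval t (tmul a b) = teval t a * teval t b.
Proof.
  unfold teval, tmul; simpl fst; simpl snd; rewrite peval_mul, pow_add.
  pose proof (den_pos t (snd a)); pose proof (den_pos t (snd b)); field; lra.
Qed.

Lemma teval_int t z : teval t (tint z) = IZR z.
Proof. unfold teval; simpl; field. Qed.

Lemma teval_opp t a : teval t (topp a) = - teval t a.
Proof.
  unfold teval, topp; simpl fst; simpl snd; rewrite peval_scale.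
  pose proof (den_pos t (snd a)); field; lra.
Qed.

Lemma teval_sub t a b : teval t (tsub a b) = teval t a - teval t b.
Proof. unfold tsub; rewrite teval_add, teval_opp; ring. Qed.

Definition tpos (a : trig) : bool := pos01 (fst a).
Definition tzero (a : trig) : bool := zero_poly (fst a).

Lemma tpos_sound t a : tpos a = true -> 0 < t <= 1 -> 0 < teval t a.
Proof.
  intros H Ht; unfold teval; apply Rdiv_lt_0_compat.
  - apply pos01_sound; assumption.
  - apply den_pos.
Qed.

Lemma tzero_sound t a : tzero a = true -> teval t a = 0.
Proof. intros H; unfold teval; rewrite (zero_poly_sound _ t H); unfold Rdiv; ring. Qed.

Definition tnonneg (a : trig) : bool := tpos a || tzero a.

Lemma tnonneg_sound t a : tnonneg a = true -> 0 < t <= 1 -> 0 <= teval t a.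
Proof.
  intros H Ht; apply orb_prop in H; destruct H as [H|H].
  - apply Rlt_le, tpos_sound; assumption.
  - rewrite (tzero_sound _ _ H); lra.
Qed.

Definition tvec := (trig * trig)%type.

Definition tvadd (v w : tvec) : tvec := (tadd (fst v) (fst w), tadd (snd v) (snd w)).
Definition tvsub (v w : tvec) : tvec := (tsub (fst v) (fst w), tsub (snd v) (snd w)).
Definition tvscale (k : trig) (v : tvec) : tvec := (tmul k (fst v), tmul k (snd v)).
Definition tdot (v w : tvec) : trig :=
  tadd (tmul (fst v) (fst w)) (tmul (snd v) (snd w)).
Definition tveval (t : R) (v : tvec) : pt := (teval t (fst v), teval t (snd v)).

Lemma teval_dot t v w : teval t (tdot v w) = dot (tveval t v) (tveval t w).
Proof. unfold tdot, dot; rewrite teval_add, !teval_mul; reflexivity. Qed.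

Lemma tveval_sub t v w : tveval t (tvsub v w) = vsub (tveval t v) (tveval t w).
Proof. unfold tvsub, vsub, tveval; simpl; rewrite !teval_sub; reflexivity. Qed.

(** Addition theorems; [c1] and [s1] are the half-angle forms of [cos phi] and [sin phi], with
    [289 = 17^2]. *)
Fixpoint cis_nat (n : nat) : tvec :=
  match n with
  | O => (tint 1, tint 0)
  | S n' => let (c, s) := cis_nat n' in
            let c1 := ([289; 0; -4]%Z, 1%nat) in
            let s1 := ([0; 68]%Z, 1%nat) in
            (tsub (tmul c c1) (tmul s s1), tadd (tmul s c1) (tmul c s1))
  end.

Definition cis (n : Z) : tvec :=
  let (c, s) := cis_nat (Z.abs_nat n) in if (n <? 0)%Z then (c, topp s) else (c, s).

Fixpoint quarter_turns (q : nat) (v : tvec) : tvec :=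
  match q with
  | O => v
  | S q' => let (c, s) := quarter_turns q' v in (topp s, c)
  end.

Definition tdir (q : nat) (n : Z) : tvec := quarter_turns q (cis n).

(** In the application [PI / 2] is [(4 k + 3) * phi]; counting quarter turns separately keeps the
    formulas free of [k]. *)
Definition dir (phi : R) (q : nat) (n : Z) : pt :=
  (cos (IZR n * phi + INR q * (PI / 2)), sin (IZR n * phi + INR q * (PI / 2))).

Definition half_angle (phi t : R) : Prop :=
  cos phi = (289 - 4 * t ^ 2) / (289 + 4 * t ^ 2) /\ sin phi = 68 * t / (289 + 4 * t ^ 2).

Lemma tveval_cis_nat phi t n : half_angle phi t ->
  tveval t (cis_nat n) = (cos (INR n * phi), sin (INR n * phi)).
Proof.
  intros [Hc Hs]; induction n as [|n IH].
  - unfold tveval; simpl fst; simpl snd; rewrite !teval_int, Rmult_0_l, cos_0, sin_0.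
    reflexivity.
  - rewrite S_INR, Rmult_plus_distr_r, Rmult_1_l, cos_plus, sin_plus.
    cbn [cis_nat]; destruct (cis_nat n) as [c s]; unfold tveval in *.
    simpl fst in *; simpl snd in *; injection IH as <- <-.
    rewrite teval_sub, teval_add, !teval_mul.
    replace (teval t ([289; 0; -4]%Z, 1%nat)) with (cos phi)
      by (rewrite Hc; unfold teval; simpl; field; nra).
    replace (teval t ([0; 68]%Z, 1%nat)) with (sin phi)
      by (rewrite Hs; unfold teval; simpl; field; nra).
    reflexivity.
Qed.

Lemma tveval_cis phi t n : half_angle phi t ->
  tveval t (cis n) = (cos (IZR n * phi), sin (IZR n * phi)).
Proof.
  intros H; unfold cis.
  pose proof (tveval_cis_nat phi t (Z.abs_nat n) H) as E.
  rewrite INR_IZR_INZ, Zabs2Nat.id_abs in E.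
  destruct (cis_nat (Z.abs_nat n)) as [c s].
  unfold tveval in E; simpl in E; injection E as E1 E2.
  destruct (Z.ltb_spec n 0) as [Hn|Hn]; unfold tveval; simpl.
  - rewrite teval_opp, E1, E2, Z.abs_neq, opp_IZR by lia.
    replace (- IZR n * phi) with (- (IZR n * phi)) by ring.
    rewrite cos_neg, sin_neg, Ropp_involutive; reflexivity.
  - rewrite E1, E2, Z.abs_eq by lia; reflexivity.
Qed.

Lemma tveval_dir phi t q n : half_angle phi t -> tveval t (tdir q n) = dir phi q n.
Proof.
  intros H; unfold tdir, dir; induction q as [|q IH].
  - simpl quarter_turns; rewrite (tveval_cis phi t n H); simpl INR.
    rewrite Rmult_0_l, Rplus_0_r; reflexivity.
  - cbn [quarter_turns]; destruct (quarter_turns q (cis n)) as [c s].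
    unfold tveval in *; simpl in IH; injection IH as E1 E2; simpl fst; simpl snd.
    rewrite teval_opp, E1, E2, S_INR.
    replace (IZR n * phi + (INR q + 1) * (PI / 2))
      with (PI / 2 + (IZR n * phi + INR q * (PI / 2))) by ring.
    rewrite <- cos_sin, (cos_plus (PI / 2)), cos_PI2, sin_PI2; f_equal; ring.
Qed.

(** * The configuration *)

Definition tcos (n : Z) : trig := fst (cis n).
Definition tsin (n : Z) : trig := snd (cis n).
Definition tfour : trig := tint 4.

(* Lengths in the limit configuration, all multiplied by [4 cos phi cos^3 (2 phi)]:
   [|u w|], [|u v1|], [|v1 v2|], [|v1 v3|], [|v2 w|] and the length of the path. *)
Definition len_uw : trig := tmul tfour (tmul (tcos 1) (tmul (tcos 2) (tmul (tcos 2) (tcos 2)))).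
Definition len_uv1 : trig := tmul tfour (tmul (tmul (tcos 1) (tcos 1)) (tmul (tcos 2) (tcos 2))).
Definition len_v1v2 : trig := tmul tfour (tmul (tmul (tcos 1) (tcos 2)) (tmul (tsin 3) (tsin 1))).
Definition len_v1v3 : trig := tmul (tsin 3) (tsin 3).
Definition len_v2w : trig := tmul tfour (tmul (tmul (tcos 1) (tcos 1)) (tmul (tcos 2) (tsin 3))).
(** The path is [u], [v1], [v3], [v2], [w], with [v3] the blocker of [v1 -> v2]. In the same scale
    [|v3 v2| = sin phi sin (3 phi)], so [|v1 v3| + |v3 v2| = 4 cos^2 phi sin phi sin (3 phi)]. *)
Definition len_path : trig :=
  tadd len_uv1
    (tmul tfour (tmul (tmul (tcos 1) (tcos 1)) (tmul (tsin 3) (tadd (tcos 2) (tsin 1))))).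

(** An entry [(k, n, q)] is a displacement of length [k] in direction [n * phi + q * PI / 2]. *)
Definition steps := list (trig * Z * nat).

Definition walk_steps (l : steps) : tvec :=
  fold_right (fun '(k, n, q) v => tvadd (tvscale k (tdir q n)) v) (tint 0, tint 0) l.

(* The segment [u w] has direction [PI / 2 - phi], so the reflection that exchanges [u] and [w]
   sends the direction [a] to [- 2 phi - a]. *)
Definition mirror_steps (l : steps) : steps :=
  map (fun '(k, n, q) => (k, (-2 - n)%Z, (4 - q)%nat)) l.

(* Limit position, direction [d] of the displacement by [delta * d], and potential. *)
Definition node := (tvec * tvec * trig)%type.
Definition nd_pos (x : node) : tvec := fst (fst x).
Definition nd_drift (x : node) : tvec := snd (fst x).
Definition nd_pot (x : node) : trig := snd x.

(* In this order: [u], [v1], the blocker of [v1 -> v2], [v2], the blocker of [v2 -> v1], the point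
   [v2'] that destroys the edge from [v1] to [w], the blockers of [w -> v2'] and of [v2' -> w], and
   the point that keeps [u] from the blocker of [v2 -> v1].  In [nodes], number [9 + i] is the
   mirror image of number [i]; thus [u] is number 0 and [w] is number 9. *)
Definition half_nodes : list (steps * steps * trig) :=
  let K := len_uw in let A := len_uv1 in let N := len_v1v2 in let Y := len_v1v3 in
  [ ([], [], tint 0);
    ([(A, 2%Z, 1%nat)], [(tint 1, (-1)%Z, 0%nat)], A);
    ([(A, 2%Z, 1%nat); (Y, 2%Z, 1%nat)], [(tint 2, 0%Z, 0%nat)], tadd A Y);
    ([(A, 2%Z, 1%nat); (N, 1%Z, 1%nat)], [(tint 2, (-2)%Z, 0%nat)], tsub len_path len_v2w);
    ([(A, 2%Z, 1%nat); (N, 1%Z, 1%nat); (Y, 0%Z, 3%nat)], [(tint 3, 0%Z, 0%nat)],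
     tsub (tsub len_path len_v2w) Y);
    ([(K, (-1)%Z, 1%nat); (N, (-1)%Z, 1%nat)], [(tint 1, (-2)%Z, 3%nat)], tadd A len_v2w);
    ([(K, (-1)%Z, 1%nat); (Y, (-2)%Z, 1%nat)], [(tint 1, 0%Z, 2%nat)], tsub len_path Y);
    ([(K, (-1)%Z, 1%nat); (N, (-1)%Z, 1%nat); (Y, 0%Z, 3%nat)], [(tint 1, 0%Z, 2%nat)],
     tadd (tadd A len_v2w) Y);
    ([(tmul K (tcos 1), 3%Z, 1%nat)], [], tmul K (tcos 1)) ].

Definition nodes : list node :=
  map (fun '(p, d, s) => (walk_steps p, walk_steps d, s)) half_nodes ++
  map (fun '(p, d, s) =>
         (tvadd (tvscale len_uw (tdir 1 (-1))) (walk_steps (mirror_steps p)),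
          walk_steps (mirror_steps d), tsub len_path s)) half_nodes.

Definition dflt : node := (tint 0, tint 0, (tint 0, tint 0), tint 0).
Definition nd (l : list node) (i : nat) : node := nth i l dflt.

(* [Far q n] certifies that the distance of the two points is at least the difference of their
   potentials, by projection onto [tdir q n].  [Blocked q1 n1 r1 q2 n2 r2], for the pair [i], [j],
   certifies that point [r1] destroys the edge from [j] to [i] within the cone with bisector
   [tdir q1 n1], and [r2] the edge from [i] to [j] within the cone with bisector [tdir q2 n2]. *)
Inductive certificate :=
| Far (q : nat) (n : Z)
| Blocked (q1 : nat) (n1 : Z) (r1 : nat) (q2 : nat) (n2 : Z) (r2 : nat).

(* Positivity at [p + delta * d] for small [delta > 0]. *)
Definition lex_pos (x y : node) (e : tvec) : bool :=
  let f := tdot (tvsub (nd_pos y) (nd_pos x)) e in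
  tpos f || (tzero f && tpos (tdot (tvsub (nd_drift y) (nd_drift x)) e)).

(* [tdir q n] is a bisector iff [n = q + 3] modulo 4, since [4 k + 3] times [phi] is [PI / 2];
   [e1] and [e2] are the inner normals of the two sides of its cone. *)
Definition check_blocked (l : list node) (i j q : nat) (n : Z) (r : nat) : bool :=
  let x := nd l i in let y := nd l j in let z := nd l r in
  let e1 := tdir (q + 3) (n + 2) in let e2 := tdir (q + 1) (n - 2) in
  (r <? 18)%nat && ((n - 3 - Z.of_nat q) mod 4 =? 0)%Z &&
  lex_pos x y e1 && lex_pos x y e2 && lex_pos x z e1 && lex_pos x z e2 &&
  lex_pos z y (tdir q n).

(** The two [tnonneg] tests give [|s| <= f]. Since [f > 0], this becomes strict once [s] is shrunk
    by a factor below 1, even where [f = |s|]. *)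
Definition check_pair (l : list node) (i j : nat) (c : certificate) : bool :=
  match c with
  | Far q n =>
      let f := tdot (tvsub (nd_pos (nd l j)) (nd_pos (nd l i))) (tdir q n) in
      let s := tsub (nd_pot (nd l j)) (nd_pot (nd l i)) in
      tpos f && tnonneg (tsub f s) && tnonneg (tadd f s)
  | Blocked q1 n1 r1 q2 n2 r2 =>
      check_blocked l j i q1 n1 r1 && check_blocked l i j q2 n2 r2
  end.

(* The entry [j] of row [i] is for the pair [i], [j]. *)
Definition certificates : list (list certificate) := [
  [];
  [ Far 3 2];
  [ Far 3 2; Far 3 2];
  [ Blocked 1 0 1 3 2 1; Blocked 1 0 2 3 2 4; Far 3 (-2)];
  [ Blocked 1 4 8 3 2 1; Far 3 4; Far 1 1; Far 1 0];
  [ Blocked 1 0 1 3 (-2) 7; Far 2 1; Far 2 0; Far 2 0; Far 2 1];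
  [ Blocked 1 0 1 3 (-2) 7; Blocked 0 (-1) 5 2 1 3; Far 2 0; Far 2 0;
    Far 2 1; Far 1 2];
  [ Blocked 1 0 1 3 (-2) 9; Blocked 0 (-1) 5 2 1 3; Far 2 (-1); Far 2 (-1);
    Blocked 0 (-1) 5 2 1 1; Far 1 0; Far 1 (-1)];
  [ Far 3 3; Far 3 11; Far 1 (-1); Far 1 (-1); Far 3 12; Far 0 2; Far 0 2;
    Blocked 2 1 1 0 3 1];
  [ Blocked 1 0 1 3 (-2) 10; Blocked 0 (-1) 5 2 1 3;
    Blocked 0 (-1) 5 2 1 1; Far 2 (-1); Blocked 0 (-1) 5 2 1 1;
    Blocked 3 (-2) 7 1 0 6; Far 1 (-2); Far 1 (-4); Blocked 0 3 1 2 1 1];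
  [ Blocked 2 (-3) 12 0 (-1) 14; Far 1 (-1); Far 1 (-1); Far 1 (-1); Far 1 (-1);
    Far 1 (-4); Far 1 (-4); Far 1 (-4); Far 1 0; Far 1 (-4)];
  [ Blocked 2 (-3) 10 0 (-1) 14; Far 1 (-1); Far 1 (-1); Far 1 (-1); Far 1 (-1);
    Far 1 (-4); Far 1 (-4); Far 1 (-4); Far 1 0; Far 1 (-4); Far 1 (-4)];
  [ Far 0 (-1); Far 1 (-1); Far 1 (-1); Far 1 (-1); Far 1 (-1); Far 1 (-4); Far 1 (-4);
    Far 1 (-4); Far 1 0; Blocked 3 (-2) 0 1 (-4) 10;
    Blocked 3 (-2) 11 1 (-4) 13; Far 1 0];
  [ Blocked 2 (-3) 10 0 (-1) 14; Far 1 (-1); Far 1 (-1); Far 1 (-1); Far 1 (-1);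
    Far 1 (-4); Far 1 (-4); Far 1 (-4); Far 1 0; Blocked 3 (-6) 17 1 (-4) 10;
    Far 1 (-6); Far 3 (-3); Far 3 (-2)];
  [ Blocked 3 (-2) 15 1 0 16; Far 1 2; Far 1 2; Far 1 2; Far 1 2;
    Blocked 3 (-2) 0 1 0 0; Blocked 3 (-2) 0 1 0 0;
    Blocked 3 (-2) 0 1 0 0; Far 1 3; Blocked 3 (-2) 0 1 0 0; Far 2 (-3);
    Far 2 (-2); Far 2 (-2); Far 2 (-3)];
  [ Far 1 0; Far 1 2; Far 1 2; Far 1 2; Far 1 2; Blocked 3 (-2) 0 1 0 0;
    Blocked 3 (-2) 0 1 0 0; Blocked 3 (-2) 0 1 0 0; Far 1 3;
    Blocked 3 (-2) 0 1 0 0; Blocked 0 (-1) 0 2 (-3) 12; Far 2 (-2);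
    Far 2 (-2); Far 2 (-3); Far 3 (-4)];
  [ Far 1 2; Far 1 2; Far 1 2; Far 1 2; Far 1 2; Blocked 3 (-2) 0 1 0 0;
    Blocked 3 (-2) 0 1 0 0; Blocked 3 (-2) 0 1 0 0; Far 1 3;
    Blocked 3 (-2) 0 1 0 0; Blocked 0 (-1) 0 2 (-3) 12; Far 2 (-1);
    Far 2 (-1); Blocked 0 (-1) 0 2 (-3) 10; Far 3 (-2); Far 3 (-1)];
  [ Blocked 2 (-3) 10 0 (-5) 10; Far 1 (-2); Far 1 (-2); Far 1 (-2); Far 1 (-2);
    Far 1 (-5); Far 1 (-5); Far 1 (-5); Far 1 (-1); Far 1 (-5); Far 1 (-13); Far 3 (-1);
    Far 3 (-1); Far 1 (-14); Far 0 (-4); Far 0 (-4); Blocked 2 (-3) 10 0 (-5) 0]].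

(** Separation is symmetric, so [j < i] suffices. A default produced by [nth] is checked like any
    listed certificate. *)
Definition check_all (l : list node) : bool :=
  forallb (fun i =>
    forallb (fun j => check_pair l i j (nth j (nth i certificates []) (Far 0 0))) (seq 0 i))
    (seq 0 18).

(** Exact integer arithmetic, valid for all [t] in (0, 1] and hence for every [k >= 1] at once. *)
Lemma check_all_nodes : check_all nodes = true.
Proof. vm_compute; reflexivity. Qed.

Lemma nodes_u : nd nodes 0 = (walk_steps [], walk_steps [], tint 0).
Proof. reflexivity. Qed.

Lemma nodes_w : nd nodes 9 =
  (tvadd (tvscale len_uw (tdir 1 (-1))) (walk_steps []), walk_steps [], tsub len_path (tint 0)).
Proof. reflexivity. Qed.

Lemma len_uw_tpos : tpos len_uw = true.
Proof. vm_compute; reflexivity. Qed.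

Lemma len_path_tpos : tpos len_path = true.
Proof. vm_compute; reflexivity. Qed.

#[local] Opaque nodes.

(** * Cones *)

Lemma cos_period_Z x z : cos (x + 2 * IZR z * PI) = cos x.
Proof.
  destruct (Z_le_gt_dec 0 z) as [H|H].
  - rewrite <- (Z2Nat.id z H), <- INR_IZR_INZ; apply cos_period.
  - rewrite <- (cos_period (x + 2 * IZR z * PI) (Z.to_nat (- z))).
    rewrite INR_IZR_INZ, Z2Nat.id, opp_IZR by lia; f_equal; ring.
Qed.

Lemma sin_period_Z x z : sin (x + 2 * IZR z * PI) = sin x.
Proof.
  destruct (Z_le_gt_dec 0 z) as [H|H].
  - rewrite <- (Z2Nat.id z H), <- INR_IZR_INZ; apply sin_period.
  - rewrite <- (sin_period (x + 2 * IZR z * PI) (Z.to_nat (- z))).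
    rewrite INR_IZR_INZ, Z2Nat.id, opp_IZR by lia; f_equal; ring.
Qed.

Lemma cone_angle_mult m : (0 < m)%nat -> IZR (Z.of_nat m) * cone_angle m = 2 * PI.
Proof.
  intros H; unfold cone_angle; rewrite <- INR_IZR_INZ; field.
  apply not_0_INR; lia.
Qed.

Lemma bisector_Z m b : (0 < m)%nat -> exists i, (i < m)%nat /\
  bisector m i = (cos (PI / 2 - IZR b * cone_angle m), sin (PI / 2 - IZR b * cone_angle m)).
Proof.
  intros Hm; pose proof (cone_angle_mult m Hm) as E.
  assert (HM : (0 < Z.of_nat m)%Z) by lia.
  pose proof (Z.mod_pos_bound b _ HM) as B.
  exists (Z.to_nat (b mod Z.of_nat m)); split; [lia|].
  unfold bisector; rewrite INR_IZR_INZ, Z2Nat.id by lia.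
  assert (Hb : PI / 2 - IZR (b mod Z.of_nat m) * cone_angle m =
    PI / 2 - IZR b * cone_angle m + 2 * IZR (b / Z.of_nat m) * PI).
  { pose proof (Z.div_mod b (Z.of_nat m) ltac:(lia)) as D.
    rewrite D at 2; rewrite plus_IZR, mult_IZR.
    replace (2 * IZR (b / Z.of_nat m) * PI)
      with (IZR (b / Z.of_nat m) * (IZR (Z.of_nat m) * cone_angle m)) by (rewrite E; ring).
    ring. }
  rewrite Hb, cos_period_Z, sin_period_Z; reflexivity.
Qed.

(** With [M = 4 k + 3] and [PI / 2 = M * phi], the number [b] of the bisector solves
    [4 b = (1 - q) M - n]; as [M] is 3 modulo 4, divisibility by 4 means that [n] is [q + 3] modulo
    4. *)
Lemma bisector_dir k q n : ((n - 3 - Z.of_nat q) mod 4 = 0)%Z ->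
  exists i, (i < 4 * k + 3)%nat /\
    bisector (4 * k + 3) i = dir (cone_angle (4 * k + 3) / 4) q n.
Proof.
  intros H; apply Z.mod_divide in H; [|lia]; destruct H as [d Hd].
  set (M := Z.of_nat (4 * k + 3)).
  assert (Hb : exists b, (4 * b = (1 - Z.of_nat q) * M - n)%Z).
  { exists ((1 - Z.of_nat q) * Z.of_nat k - Z.of_nat q - d)%Z; unfold M; nia. }
  destruct Hb as [b Hb].
  destruct (bisector_Z (4 * k + 3) b) as [i [Hi E]]; [lia|].
  exists i; split; [exact Hi|]; rewrite E; unfold dir.
  pose proof (cone_angle_mult (4 * k + 3) ltac:(lia)) as EM; fold M in EM.
  set (th := cone_angle (4 * k + 3)) in *.
  assert (HbR : 4 * IZR b = (1 - INR q) * IZR M - IZR n).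
  { rewrite (INR_IZR_INZ q), <- minus_IZR, <- !mult_IZR, <- minus_IZR; f_equal; exact Hb. }
  replace (PI / 2 - IZR b * th) with (IZR n * (th / 4) + INR q * (PI / 2)); [reflexivity|].
  replace (IZR b) with (((1 - INR q) * IZR M - IZR n) / 4) by lra.
  replace (PI / 2) with (IZR M * th / 4) by lra.
  field.
Qed.

Lemma edist_norm2 p q : edist p q * edist p q = dot (vsub p q) (vsub p q).
Proof.
  unfold edist, dot, vsub; simpl fst; simpl snd; rewrite sqrt_sqrt; [ring|].
  apply Rplus_le_le_0_compat; apply pow2_ge_0.
Qed.

Lemma edist_nonneg p q : 0 <= edist p q.
Proof. apply sqrt_pos. Qed.

Lemma edist_sym p q : edist p q = edist q p.
Proof. unfold edist; f_equal; ring. Qed.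

Lemma edist_pos p q : p <> q -> 0 < edist p q.
Proof.
  intros H; apply sqrt_lt_R0.
  destruct (Rle_lt_dec ((fst p - fst q) ^ 2 + (snd p - snd q) ^ 2) 0) as [H0|]; [|assumption].
  exfalso; apply H; destruct p as [a b], q as [c d]; cbn [fst snd] in H0.
  pose proof (pow2_ge_0 (a - c)); pose proof (pow2_ge_0 (b - d)).
  assert (a - c = 0) by (apply Rsqr_0_uniq; unfold Rsqr; nra).
  assert (b - d = 0) by (apply Rsqr_0_uniq; unfold Rsqr; nra).
  f_equal; lra.
Qed.

(** Cauchy-Schwarz, from [|w|^2 |e|^2 = (w . e)^2 + (w x e)^2]. *)
Lemma dot_le_edist p q e : dot e e = 1 -> dot (vsub p q) e <= edist p q.
Proof.
  intros He; pose proof (edist_nonneg p q) as H0; pose proof (edist_norm2 p q) as H.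
  apply Rsqr_incr_0_var; [|exact H0]; unfold Rsqr; rewrite H.
  set (w := vsub p q).
  replace (dot w w) with (dot w w * dot e e) by (rewrite He; ring).
  unfold dot; pose proof (pow2_ge_0 (fst w * snd e - snd w * fst e)); nra.
Qed.

(* [x] and [y] are the coordinates of a vector along and across the bisector. *)
Lemma sector_bound x y r s c : 0 < s -> 0 < c -> s * s + c * c = 1 ->
  0 <= r -> r * r = x * x + y * y ->
  0 < s * x - c * y -> 0 < s * x + c * y -> r * c < x.
Proof.
  intros Hs Hc E Hr Er H1 H2.
  assert (Hx : 0 < x) by nra.
  assert (c * c * (y * y) < s * s * (x * x)) by nra.
  apply Rnot_le_lt; intros Hn.
  assert (x * x <= (r * c) * (r * c)) by (apply Rmult_le_compat; lra).
  nra.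
Qed.

Lemma dir_norm phi q n : dot (dir phi q n) (dir phi q n) = 1.
Proof.
  unfold dot, dir; simpl fst; simpl snd.
  set (a := IZR n * phi + INR q * (PI / 2)).
  pose proof (sin2_cos2 a) as H; unfold Rsqr in H; lra.
Qed.

(** The open cone of half-angle [2 phi] about the angle [b] is cut out by two half-planes with inner
    normals at [b + 2 phi - PI / 2] and [b - 2 phi + PI / 2]; [q + 3] quarter turns stand for
    [q - 1]. This makes cone membership linear. *)
Lemma inner_normals_cone phi q n (u v : pt) : 0 < phi -> 2 * phi < PI / 2 ->
  0 < dot (vsub v u) (dir phi (q + 3) (n + 2)) ->
  0 < dot (vsub v u) (dir phi (q + 1) (n - 2)) ->
  edist v u * cos (2 * phi) < dot (vsub v u) (dir phi q n).
Proof.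
  intros Hp0 Hp1 H1 H2.
  assert (Hs : 0 < sin (2 * phi)) by (apply sin_gt_0; lra).
  assert (Hc : 0 < cos (2 * phi)) by (apply cos_gt_0; lra).
  pose proof (edist_norm2 v u) as Er.
  revert H1 H2 Er; generalize (vsub v u); intros w H1 H2 Er.
  unfold dir, dot in H1, H2 |- *; simpl fst in *; simpl snd in *.
  rewrite plus_IZR, plus_INR in H1; rewrite minus_IZR, plus_INR in H2.
  set (b := IZR n * phi + INR q * (PI / 2)) in *.
  replace ((IZR n + 2) * phi + (INR q + INR 3) * (PI / 2)) with ((b + 2 * phi) + 3 * (PI / 2))
    in H1 by (unfold b; simpl INR; ring).
  replace ((IZR n - 2) * phi + (INR q + INR 1) * (PI / 2)) with (PI / 2 + (b - 2 * phi))
    in H2 by (unfold b; simpl INR; ring).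
  rewrite (cos_plus (b + _)), (sin_plus (b + _)), cos_3PI2, sin_3PI2, cos_plus, sin_plus in H1.
  rewrite <- cos_sin, (cos_plus (PI / 2)), cos_PI2, sin_PI2, cos_minus, sin_minus in H2.
  pose proof (sin2_cos2 b) as Eb; pose proof (sin2_cos2 (2 * phi)) as Ep; unfold Rsqr in *.
  apply (sector_bound _ (snd w * cos b - fst w * sin b) _ (sin (2 * phi))); try assumption.
  - apply edist_nonneg.
  - rewrite Er; unfold dot.
    transitivity ((fst w * fst w + snd w * snd w) * (sin b * sin b + cos b * cos b));
      [rewrite Eb; ring | ring].
  - nra.
  - nra.
Qed.

Lemma cos_le_outside th x : 0 <= th <= PI -> th <= x <= 2 * PI - th -> cos x <= cos th.
Proof.
  intros Ht Hx; destruct (Rle_dec x PI) as [H|H].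
  - apply cos_decr_1; lra.
  - replace (cos x) with (cos (2 * PI - x))
      by (rewrite cos_minus, cos_2PI, sin_2PI; ring).
    apply cos_decr_1; lra.
Qed.

Lemma cos_bisectors m i j : (i < j < m)%nat ->
  dot (bisector m i) (bisector m j) <= cos (cone_angle m).
Proof.
  intros [Hij Hj]; unfold dot, bisector; simpl fst; simpl snd.
  rewrite <- cos_minus.
  replace (PI / 2 - INR i * cone_angle m - (PI / 2 - INR j * cone_angle m))
    with ((INR j - INR i) * cone_angle m) by ring.
  pose proof (cone_angle_mult m ltac:(lia)) as E; rewrite <- INR_IZR_INZ in E.
  pose proof PI_RGT_0 as HP.
  assert (Hm : 2 <= INR m) by (apply (le_INR 2); lia).
  assert (Ht : 0 < cone_angle m) by (unfold cone_angle; apply Rdiv_lt_0_compat; lra).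
  assert (H1 : 1 <= INR j - INR i).
  { rewrite <- minus_INR by lia; apply (le_INR 1); lia. }
  assert (H2 : INR j - INR i <= INR m - 1).
  { rewrite <- minus_INR by lia; enough (INR (j - i) + 1 <= INR m) by lra.
    rewrite <- S_INR; apply le_INR; lia. }
  apply cos_le_outside; nra.
Qed.

Lemma bisector_norm m i : dot (bisector m i) (bisector m i) = 1.
Proof.
  unfold dot, bisector; simpl fst; simpl snd.
  set (a := PI / 2 - INR i * cone_angle m).
  pose proof (sin2_cos2 a) as H; unfold Rsqr in H; lra.
Qed.

(** Two directions within an angle of [v], one strictly, differ by less than twice that angle: in
    [r^2 (a . b) = (v . a)(v . b) + (v x a)(v x b)] the first product exceeds [r^2 c^2] and the
    second is at least [- r^2 s^2]. *)
Lemma sector_vectors_close (a b v : pt) r c s : dot a a = 1 -> dot b b = 1 ->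
  0 < r -> r * r = dot v v -> 0 < c -> s * s + c * c = 1 ->
  r * c < dot v a -> r * c <= dot v b -> c * c - s * s < dot a b.
Proof.
  intros Ha Hb Hr Er Hc Es H1 H2.
  assert (E1 : r * r = dot v a * dot v a + cross v a * cross v a).
  { transitivity (dot v v * dot a a); [rewrite Ha; lra | unfold dot, cross; ring]. }
  assert (E2 : r * r = dot v b * dot v b + cross v b * cross v b).
  { transitivity (dot v v * dot b b); [rewrite Hb; lra | unfold dot, cross; ring]. }
  assert (E3 : r * r * dot a b = dot v a * dot v b + cross v a * cross v b).
  { rewrite Er; unfold dot, cross; ring. }
  set (x := dot v a) in *; set (y := dot v b) in *.
  set (x' := cross v a) in *; set (y' := cross v b) in *.
  assert (P : 0 < r * c) by nra.
  assert ((r * c) * (r * c) < x * y) by nra.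
  assert (x' * x' <= r * r * (s * s)) by nra.
  assert (y' * y' <= r * r * (s * s)) by nra.
  assert (- (r * r * (s * s)) <= x' * y') by nra.
  assert (r * r * (c * c - s * s) < r * r * dot a b) by nra.
  nra.
Qed.

(** Otherwise two distinct bisectors would enclose an angle below [theta]. *)
Lemma cone_unique m i j u v : (3 <= m)%nat -> (i < m)%nat -> (j < m)%nat -> v <> u ->
  edist v u * cos (cone_angle m / 2) < dot (vsub v u) (bisector m i) ->
  in_cone m j u v -> i = j.
Proof.
  intros Hm Hi Hj Hv H1 [_ H2].
  pose proof PI_RGT_0 as HP.
  assert (Hm' : 3 <= INR m) by (pose proof (le_INR 3 m ltac:(lia)) as H3; simpl in H3; lra).
  assert (Ht : 0 < cone_angle m) by (unfold cone_angle; apply Rdiv_lt_0_compat; lra).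
  assert (Ht' : cone_angle m / 2 < PI / 2).
  { unfold cone_angle; apply (Rmult_lt_reg_r (INR m)); [lra|].
    replace (2 * PI / INR m / 2 * INR m) with PI by (field; lra); nra. }
  assert (Hc : 0 < cos (cone_angle m / 2)) by (apply cos_gt_0; lra).
  pose proof (sin2_cos2 (cone_angle m / 2)) as Es; unfold Rsqr in Es.
  assert (H : cos (cone_angle m) < dot (bisector m i) (bisector m j)).
  { replace (cos (cone_angle m)) with
      (cos (cone_angle m / 2) * cos (cone_angle m / 2) -
       sin (cone_angle m / 2) * sin (cone_angle m / 2))
      by (rewrite <- cos_plus; f_equal; lra).
    apply (sector_vectors_close _ _ (vsub v u) (edist v u));
      try assumption; try apply bisector_norm.
    - apply edist_pos; assumption.
    - apply edist_norm2.
    - lra. }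
  destruct (lt_eq_lt_dec i j) as [[L|L]|L]; [|exact L|]; exfalso.
  - pose proof (cos_bisectors m i j (conj L Hj)); lra.
  - pose proof (cos_bisectors m j i (conj L Hi)) as H'.
    replace (dot (bisector m j) (bisector m i)) with (dot (bisector m i) (bisector m j)) in H'
      by (unfold dot; ring); lra.
Qed.

Lemma unit_circle_angle x y : x * x + y * y = 1 -> exists a, x = cos a /\ y = sin a.
Proof.
  intros H; assert (Hx : -1 <= x <= 1) by nra.
  destruct (Rle_dec 0 y) as [Hy|Hy].
  - exists (acos x); rewrite cos_acos, sin_acos by assumption; split; [reflexivity|].
    replace (1 - x²) with (y * y) by (unfold Rsqr; lra); rewrite sqrt_square; lra.
  - exists (- acos x); rewrite cos_neg, sin_neg, cos_acos, sin_acos by assumption.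
    split; [reflexivity|].
    replace (1 - x²) with ((- y) * (- y)) by (unfold Rsqr; lra); rewrite sqrt_square; lra.
Qed.

Lemma cone_cover m u v : (2 <= m)%nat -> v <> u -> exists i, (i < m)%nat /\ in_cone m i u v.
Proof.
  intros Hm Hv; pose proof (edist_pos v u Hv) as Hr; pose proof (edist_norm2 v u) as Er.
  set (r := edist v u) in *; unfold dot in Er; remember (vsub v u) as w eqn:Ew.
  destruct (unit_circle_angle (fst w / r) (snd w / r)) as [a [Ex Ey]].
  { replace (fst w / r * (fst w / r) + snd w / r * (snd w / r))
      with ((fst w * fst w + snd w * snd w) / (r * r)) by (field; lra).
    rewrite <- Er; field; lra. }
  pose proof PI_RGT_0 as HP.
  assert (Hm' : 2 <= INR m) by (apply (le_INR 2); lia).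
  assert (Ht : 0 < cone_angle m) by (unfold cone_angle; apply Rdiv_lt_0_compat; lra).
  assert (Ht' : cone_angle m <= PI).
  { unfold cone_angle; apply (Rmult_le_reg_r (INR m)); [lra|].
    replace (2 * PI / INR m * INR m) with (2 * PI) by (field; lra); nra. }
  set (th := cone_angle m) in *.
  (* Rounding to the nearest integer selects the bisector closest in angle. *)
  set (b := Int_part ((PI / 2 - a) / th + 1 / 2)).
  destruct (bisector_Z m b ltac:(lia)) as [i [Hi Eb]].
  exists i; split; [exact Hi|]; split; [exact Hv|].
  fold r; rewrite <- Ew, Eb; fold th; unfold dot; simpl fst; simpl snd.
  replace (fst w) with (r * cos a) by (rewrite <- Ex; field; lra).
  replace (snd w) with (r * sin a) by (rewrite <- Ey; field; lra).
  set (be := PI / 2 - IZR b * th).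
  replace (r * cos a * cos be + r * sin a * sin be) with (r * cos (a - be))
    by (rewrite cos_minus; ring).
  apply Rle_ge, Rmult_le_compat_l; [lra|].
  destruct (base_Int_part ((PI / 2 - a) / th + 1 / 2)) as [B1 B2]; fold b in B1, B2.
  assert (Q : (PI / 2 - a) / th * th = PI / 2 - a) by (field; lra).
  assert (D1 : a - be <= th / 2) by (unfold be; nra).
  assert (D2 : - (th / 2) <= a - be) by (unfold be; nra).
  destruct (Rle_dec 0 (a - be)).
  - apply cos_decr_1; lra.
  - rewrite <- (cos_neg (a - be)); apply cos_decr_1; lra.
Qed.

(** * Connectivity *)

Lemma list_argmin (A : Type) (Q : A -> Prop) (f : A -> R) (l : list A) :
  (exists x, In x l /\ Q x) ->
  exists x, In x l /\ Q x /\ forall y, In y l -> Q y -> f x <= f y.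
Proof.
  induction l as [|a l IH]; intros [x [Hx HQ]]; [contradiction|].
  destruct (classic (exists y, In y l /\ Q y)) as [H|H].
  - destruct (IH H) as [y [Hy [HQy Hmin]]].
    destruct (classic (Q a /\ f a <= f y)) as [[HQa Ha]|Ha].
    + exists a; split; [left; reflexivity|split; [exact HQa|]].
      intros z [<-|Hz] HQz; [lra|]; pose proof (Hmin z Hz HQz); lra.
    + exists y; split; [right; exact Hy|split; [exact HQy|]].
      intros z [<-|Hz] HQz; [|exact (Hmin z Hz HQz)].
      apply Rnot_lt_le; intros L; apply Ha; split; [exact HQz|lra].
  - assert (HQa : Q a) by (destruct Hx as [->|Hx]; [exact HQ|exfalso; eauto]).
    exists a; split; [left; reflexivity|split; [exact HQa|]].
    intros z [<-|Hz] HQz; [lra|exfalso; eauto].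
Qed.

(* For [m >= 7] the sector has half-angle below [PI / 6], so [3 x^2 < y^2] in coordinates along
   and across the bisector. *)
Lemma narrow_cone m i u v : (7 <= m)%nat -> in_cone m i u v ->
  0 < dot (vsub v u) (bisector m i) /\
  3 * (cross (vsub v u) (bisector m i)) ^ 2 < (dot (vsub v u) (bisector m i)) ^ 2.
Proof.
  intros Hm [Hv H].
  pose proof (edist_pos v u Hv) as Hr; pose proof (edist_norm2 v u) as Er.
  pose proof PI_RGT_0 as HP.
  assert (Hm' : 7 <= INR m) by (pose proof (le_INR 7 m Hm) as H7; simpl in H7; lra).
  assert (Ht : 0 < cone_angle m / 2 < PI / 6).
  { unfold cone_angle; split.
    - apply Rdiv_lt_0_compat; [apply Rdiv_lt_0_compat|]; lra.
    - apply (Rmult_lt_reg_r (INR m)); [lra|].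
      replace (2 * PI / INR m / 2 * INR m) with PI by (field; lra); nra. }
  assert (Hc : cos (PI / 6) < cos (cone_angle m / 2)) by (apply cos_decreasing_1; lra).
  assert (H6 : 0 < cos (PI / 6)) by (apply cos_gt_0; lra).
  assert (Hc2 : 3 / 4 < cos (cone_angle m / 2) * cos (cone_angle m / 2)).
  { apply Rle_lt_trans with (cos (PI / 6) * cos (PI / 6)); [|nra].
    rewrite cos_PI6; pose proof (sqrt_sqrt 3 ltac:(lra)); nra. }
  pose proof (bisector_norm m i) as Eb.
  assert (E : edist v u * edist v u = dot (vsub v u) (bisector m i) ^ 2 +
                cross (vsub v u) (bisector m i) ^ 2).
  { rewrite Er, <- (Rmult_1_r (dot _ _)), <- Eb; unfold dot, cross; ring. }
  set (y := dot (vsub v u) (bisector m i)) in *; set (x := cross (vsub v u) (bisector m i)) in *.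
  set (r := edist v u) in *; set (c := cos (cone_angle m / 2)) in *.
  assert (0 < r * c) by (apply Rmult_lt_0_compat; lra).
  assert ((r * c) * (r * c) <= y * y) by (apply Rmult_le_compat; lra).
  split; [lra|].
  assert (r * r * (3 / 4) < r * r * (c * c)) by (apply Rmult_lt_compat_l; nra).
  nra.
Qed.

(** Take coordinates [y] along and [x] across the bisector. With [y1 <= y2] and
    [3 |x1 x2| <= y1 y2], expanding [|v w|^2] gives less than [|u w|^2]. *)
Lemma theta_step m P u w : (7 <= m)%nat -> In u P -> In w P -> w <> u ->
  exists v, theta_dedge m P u v /\ edist v w < edist u w.
Proof.
  intros Hm Hu Hw Hne.
  destruct (cone_cover m u w ltac:(lia) Hne) as [i [Hi Hcone]].
  destruct (list_argmin pt (in_cone m i u) (fun x => dot (vsub x u) (bisector m i)) P)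
    as [v [HvP [Hv Hmin]]]; [exists w; split; assumption|].
  exists v; split.
  - split; [assumption|split; [assumption|]].
    exists i; split; [assumption|split; assumption].
  - destruct (narrow_cone m i u v Hm Hv) as [V1 V2].
    destruct (narrow_cone m i u w Hm Hcone) as [W1 W2].
    pose proof (Hmin w Hw Hcone) as L; clear Hmin; simpl in L.
    pose proof (bisector_norm m i) as Eb.
    apply Rsqr_incrst_0; [|apply edist_nonneg|apply edist_nonneg].
    unfold Rsqr; rewrite (edist_sym u w), !edist_norm2.
    set (b := bisector m i) in *.
    assert (E : dot (vsub v w) (vsub v w) =
      (dot (vsub v u) b - dot (vsub w u) b) ^ 2 +
      (cross (vsub v u) b - cross (vsub w u) b) ^ 2).
    { rewrite <- (Rmult_1_r (dot (vsub v w) (vsub v w))), <- Eb; unfold dot, cross, vsub; simpl.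
      ring. }
    assert (E' : dot (vsub w u) (vsub w u) =
      (dot (vsub w u) b) ^ 2 + (cross (vsub w u) b) ^ 2).
    { rewrite <- (Rmult_1_r (dot (vsub w u) (vsub w u))), <- Eb; unfold dot, cross; ring. }
    rewrite E, E'.
    set (y1 := dot (vsub v u) b) in *; set (y2 := dot (vsub w u) b) in *.
    set (x1 := cross (vsub v u) b) in *; set (x2 := cross (vsub w u) b) in *.
    assert (X : 3 * Rabs (x1 * x2) <= y1 * y2).
    { apply Rsqr_incr_0_var; [|nra]; unfold Rsqr.
      replace (3 * Rabs (x1 * x2) * (3 * Rabs (x1 * x2)))
        with (3 * x1 ^ 2 * (3 * x2 ^ 2))
        by (pose proof (Rsqr_abs (x1 * x2)) as A; unfold Rsqr in A; nra).
      replace (y1 * y2 * (y1 * y2)) with (y1 ^ 2 * y2 ^ 2) by ring.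
      pose proof (pow2_ge_0 x1); pose proof (pow2_ge_0 x2).
      apply Rmult_le_compat; nra. }
    pose proof (Rle_abs (- (x1 * x2))) as A; rewrite Rabs_Ropp in A.
    nra.
Qed.

(** A vertex nearest to [w] among those without a walk to [w] would have a still nearer neighbour by
    [theta_step]. This keeps the bound on walks from being vacuous. *)
Lemma theta_connected m P u w : (7 <= m)%nat -> In u P -> In w P ->
  exists l, walk (theta_edge m P) u l w.
Proof.
  intros Hm Hu Hw; apply NNPP; intros Hno.
  destruct (list_argmin pt (fun x => ~ exists l, walk (theta_edge m P) x l w)
    (fun x => edist x w) P) as [x [Hx [Hxno Hmin]]]; [exists u; split; assumption|].
  destruct (classic (w = x)) as [->|Hne]; [apply Hxno; exists []; reflexivity|].
  destruct (theta_step m P x w Hm Hx Hw Hne) as [v [Hv Hlt]].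
  destruct (classic (exists l, walk (theta_edge m P) v l w)) as [[l Hl]|Hv'].
  - apply Hxno; exists (v :: l); split; [left; exact Hv|exact Hl].
  - destruct Hv as [_ [HvP _]]; pose proof (Hmin v HvP Hv'); simpl in *; lra.
Qed.

(** * General position *)

Definition near (eta : R) (p q : pt) : Prop :=
  Rabs (fst q - fst p) < eta /\ Rabs (snd q - snd p) < eta.

Lemma near_refl eta p : 0 < eta -> near eta p p.
Proof. intros H; unfold near; rewrite !Rminus_diag, Rabs_R0; split; exact H. Qed.

Lemma near_trans e1 e2 p q r : near e1 p q -> near e2 q r -> near (e1 + e2) p r.
Proof.
  intros [A B] [C D]; unfold near; split.
  - replace (fst r - fst p) with ((fst q - fst p) + (fst r - fst q)) by ring.
    eapply Rle_lt_trans; [apply Rabs_triang|lra].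
  - replace (snd r - snd p) with ((snd q - snd p) + (snd r - snd q)) by ring.
    eapply Rle_lt_trans; [apply Rabs_triang|lra].
Qed.

Lemma near_mono e1 e2 p q : e1 <= e2 -> near e1 p q -> near e2 p q.
Proof. intros H [A B]; split; lra. Qed.

Lemma bilinear_bound a b x y M eta : Rabs a < eta -> Rabs b < eta ->
  Rabs x + Rabs y <= M -> Rabs (a * x + b * y) <= eta * M.
Proof.
  intros Ha Hb HM; eapply Rle_trans; [apply Rabs_triang|]; rewrite !Rabs_mult.
  pose proof (Rabs_pos a); pose proof (Rabs_pos b);
  pose proof (Rabs_pos x); pose proof (Rabs_pos y); nra.
Qed.

(** The induction carries a whole box around [q] that misses the lines treated so far, leaving room
    to move off the next one. *)
Lemma avoid_lines (L : list (pt * pt)) (p : pt) (eta : R) : 0 < eta ->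
  exists q rho, 0 < rho /\ (forall q', near rho q q' -> near eta p q') /\
    forall q', near rho q q' -> forall v d, In (v, d) L -> d <> (0, 0) ->
      cross (vsub q' v) d <> 0.
Proof.
  intros He; induction L as [|[v d] L IH].
  - exists p, eta; split; [exact He|split; [auto|intros ? ? ? ? []]].
  - destruct IH as [q [rho [Hrho [Hsub Hav]]]].
    destruct (classic (d = (0, 0))) as [Hd|Hd].
    { exists q, rho; split; [exact Hrho|split; [exact Hsub|]].
      intros q' Hq' v' d' [E|Hin] Hd'; [injection E as <- <-; contradiction|].
      exact (Hav q' Hq' v' d' Hin Hd'). }
    assert (Hq2 : exists q2, near (rho / 2) q q2 /\ cross (vsub q2 v) d <> 0).
    { destruct (classic (cross (vsub q v) d = 0)) as [H0|H0];
        [|exists q; split; [apply near_refl; lra|exact H0]].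
      (* A move by [h] times the normal of [d] changes the cross product by [h |d|^2] and stays
         within [rho / 2]. *)
      set (h := rho / (2 * (1 + Rabs (fst d) + Rabs (snd d)))).
      pose proof (Rabs_pos (fst d)) as A1; pose proof (Rabs_pos (snd d)) as A2.
      assert (Hh : 0 < h) by (apply Rdiv_lt_0_compat; lra).
      assert (Hh' : h * (1 + Rabs (fst d) + Rabs (snd d)) = rho / 2)
        by (unfold h; field; lra).
      exists (fst q + h * snd d, snd q - h * fst d); split.
      - unfold near; simpl fst; simpl snd; split.
        + replace (fst q + h * snd d - fst q) with (h * snd d) by ring.
          rewrite Rabs_mult, (Rabs_pos_eq h) by lra; nra.
        + replace (snd q - h * fst d - snd q) with (- (h * fst d)) by ring.
          rewrite Rabs_Ropp, Rabs_mult, (Rabs_pos_eq h) by lra; nra.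
      - replace (cross (vsub (fst q + h * snd d, snd q - h * fst d) v) d)
          with (cross (vsub q v) d + h * (fst d * fst d + snd d * snd d))
          by (unfold cross, vsub; simpl; ring).
        rewrite H0; intros E; apply Hd.
        assert (fst d * fst d + snd d * snd d = 0) by nra.
        assert (fst d = 0) by (apply Rsqr_0_uniq; unfold Rsqr; nra).
        assert (snd d = 0) by (apply Rsqr_0_uniq; unfold Rsqr; nra).
        destruct d as [dx dy]; simpl in *; f_equal; assumption. }
    destruct Hq2 as [q2 [Hn Hne]].
    pose proof (Rabs_pos_lt _ Hne) as Hpos.
    set (M := 1 + Rabs (snd d) + Rabs (- fst d)).
    pose proof (Rabs_pos (snd d)) as A1; pose proof (Rabs_pos (- fst d)) as A2.
    (* Within [rho2] the cross product changes by at most half its absolute value. *)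
    set (rho2 := Rmin (rho / 2) (Rabs (cross (vsub q2 v) d) / (2 * M))).
    assert (HM : 0 < M) by (unfold M; lra).
    assert (Hr2 : 0 < rho2) by (apply Rmin_pos; [lra|apply Rdiv_lt_0_compat; lra]).
    assert (Hr2' : rho2 * M <= Rabs (cross (vsub q2 v) d) / 2).
    { apply Rle_trans with (Rabs (cross (vsub q2 v) d) / (2 * M) * M).
      - apply Rmult_le_compat_r; [lra|apply Rmin_r].
      - right; field; lra. }
    assert (Hin : forall q', near rho2 q2 q' -> near rho q q').
    { intros q' H; apply (near_mono (rho / 2 + rho2)).
      - pose proof (Rmin_l (rho / 2) (Rabs (cross (vsub q2 v) d) / (2 * M))).
        fold rho2 in H0; lra.
      - eapply near_trans; eassumption. }
    exists q2, rho2; split; [exact Hr2|split; [auto|]].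
    intros q' Hq' v' d' [E|HL] Hd'; [injection E as <- <-|exact (Hav q' (Hin q' Hq') v' d' HL Hd')].
    destruct Hq' as [B1 B2].
    pose proof (bilinear_bound _ _ (snd d) (- fst d) M rho2 B1 B2 ltac:(unfold M; lra)) as B.
    replace ((fst q' - fst q2) * snd d + (snd q' - snd q2) * - fst d)
      with (cross (vsub q' v) d - cross (vsub q2 v) d) in B
      by (unfold cross, vsub; simpl; ring).
    intros Z; rewrite Z, Rminus_0_l, Rabs_Ropp in B; lra.
Qed.

Lemma general_position_cons m P p eta : (0 < m)%nat -> 0 < eta -> general_position m P ->
  exists q, near eta p q /\ general_position m (q :: P).
Proof.
  intros Hm He [Hnd [Hpair Htri]].
  (* Forbidden lines through each [v]: along boundary rays, perpendicular to bisectors, and through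
     other points. The entry for [w = v] has direction zero, which [avoid_lines] skips. *)
  set (L := flat_map (fun v =>
    map (fun j => (v, boundary_ray m j)) (seq 0 m) ++
    map (fun i => (v, (- snd (bisector m i), fst (bisector m i)))) (seq 0 m) ++
    map (fun w => (v, vsub w v)) P) P).
  destruct (avoid_lines L p eta He) as [q [rho [Hrho [Hsub Hav]]]].
  specialize (Hsub q (near_refl rho q Hrho)); specialize (Hav q (near_refl rho q Hrho)).
  assert (HL : forall v, In v P -> forall x,
    In x (map (fun j => (v, boundary_ray m j)) (seq 0 m) ++
          map (fun i => (v, (- snd (bisector m i), fst (bisector m i)))) (seq 0 m) ++
          map (fun w => (v, vsub w v)) P) -> In x L).
  { intros v Hv x Hx; apply in_flat_map; exists v; split; assumption. }
  assert (Hray : forall v j, In v P -> (j < m)%nat -> cross (vsub q v) (boundary_ray m j) <> 0).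
  { intros v j Hv Hj; apply Hav.
    - apply (HL v Hv), in_or_app; left.
      apply (in_map (fun j => (v, boundary_ray m j))), in_seq; lia.
    - unfold boundary_ray; intros E; injection E as E1 E2.
      pose proof (sin2_cos2 (PI / 2 - INR j * cone_angle m + cone_angle m / 2)) as S.
      rewrite E1, E2 in S; unfold Rsqr in S; lra. }
  assert (Hbis : forall v i, In v P -> (i < m)%nat -> dot (vsub q v) (bisector m i) <> 0).
  { intros v i Hv Hi.
    replace (dot (vsub q v) (bisector m i))
      with (cross (vsub q v) (- snd (bisector m i), fst (bisector m i)))
      by (unfold cross, dot; simpl; ring).
    apply Hav.
    - apply (HL v Hv), in_or_app; right; apply in_or_app; left.
      apply (in_map (fun i => (v, (- snd (bisector m i), fst (bisector m i))))), in_seq; lia.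
    - pose proof (bisector_norm m i) as S; revert S; generalize (bisector m i).
      intros [x y] S E; injection E as E1 E2; unfold dot in S; simpl in S; nra. }
  assert (Hcol : forall v w, In v P -> In w P -> v <> w -> cross (vsub q v) (vsub w v) <> 0).
  { intros v w Hv Hw Hne; apply Hav.
    - apply (HL v Hv), in_or_app; right; apply in_or_app; right.
      apply (in_map (fun w => (v, vsub w v))); exact Hw.
    - intros E; apply Hne; unfold vsub in E; injection E as E1 E2.
      destruct v as [a b], w as [c d]; simpl in *; f_equal; lra. }
  exists q; split; [exact Hsub|split; [|split]].
  - constructor; [|exact Hnd]; intros Hq; apply (Hray q O Hq Hm).
    unfold cross, vsub; simpl; ring.
  - intros u v [<-|Hu] [<-|Hv] Hne.
    + contradiction.
    + split; [intros j Hj Z; apply (Hray v j Hv Hj)|intros i Hi Z; apply (Hbis v i Hv Hi)];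
        apply Ropp_eq_0_compat in Z; rewrite <- Z; unfold cross, dot, vsub; simpl; ring.
    + split; [intros j Hj|intros i Hi]; auto.
    + apply Hpair; assumption.
  - intros u v w [<-|Hu] [<-|Hv] [<-|Hw] H1 H2 H3; try contradiction.
    + intros Z; apply (Hcol v w Hv Hw H3); apply Ropp_eq_0_compat in Z; rewrite <- Z.
      unfold cross, vsub; simpl; ring.
    + apply Hcol; assumption.
    + intros Z; apply (Hcol u v Hu Hv H1); apply Ropp_eq_0_compat in Z; rewrite <- Z.
      unfold cross, vsub; simpl; ring.
    + apply Htri; assumption.
Qed.

Lemma general_position_near m targets eta : (0 < m)%nat -> 0 < eta ->
  exists P, Forall2 (near eta) targets P /\ general_position m P.
Proof.
  intros Hm He; induction targets as [|p l [P [HF HP]]].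
  - exists []; split; [constructor|].
    split; [constructor|split; intros; contradiction].
  - destruct (general_position_cons m P p eta Hm He HP) as [q [Hq HqP]].
    exists (q :: P); split; [constructor; assumption|exact HqP].
Qed.

(** * Stability under displacement *)

(* [Q] holds at [p i + delta * d i] for all small [delta > 0], and remains true when these points
   are moved a little further (by an amount that depends on [delta]). *)
Definition stable (N : nat) (p d : nat -> pt) (Q : (nat -> pt) -> Prop) : Prop :=
  exists d0, 0 < d0 /\ forall delta, 0 < delta < d0 ->
    exists eta, 0 < eta /\ forall Y,
      (forall i, (i < N)%nat ->
         near eta (fst (p i) + delta * fst (d i), snd (p i) + delta * snd (d i)) (Y i)) -> Q Y.

Lemma stable_mono N p d (Q Q' : (nat -> pt) -> Prop) :
  (forall Y, Q Y -> Q' Y) -> stable N p d Q -> stable N p d Q'.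
Proof.
  intros H [d0 [H0 Hd]]; exists d0; split; [exact H0|]; intros delta D.
  destruct (Hd delta D) as [eta [He HY]]; exists eta; split; auto.
Qed.

Lemma stable_true N p d (Q : (nat -> pt) -> Prop) : (forall Y, Q Y) -> stable N p d Q.
Proof.
  intros H; exists 1; split; [lra|]; intros delta _; exists 1; split; [lra|auto].
Qed.

Lemma stable_and N p d (Q Q' : (nat -> pt) -> Prop) :
  stable N p d Q -> stable N p d Q' -> stable N p d (fun Y => Q Y /\ Q' Y).
Proof.
  intros [d0 [H0 Hd]] [d1 [H1 Hd']]; exists (Rmin d0 d1); split; [apply Rmin_pos; assumption|].
  intros delta D; pose proof (Rmin_l d0 d1); pose proof (Rmin_r d0 d1).
  destruct (Hd delta ltac:(lra)) as [e [He HY]].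
  destruct (Hd' delta ltac:(lra)) as [e' [He' HY']].
  exists (Rmin e e'); split; [apply Rmin_pos; assumption|].
  intros Y Hn; split; [apply HY|apply HY']; intros i Hi;
    (eapply near_mono; [|apply Hn; exact Hi]); [apply Rmin_l|apply Rmin_r].
Qed.

Lemma stable_forall N p d n (Q : nat -> (nat -> pt) -> Prop) :
  (forall i, (i < n)%nat -> stable N p d (Q i)) ->
  stable N p d (fun Y => forall i, (i < n)%nat -> Q i Y).
Proof.
  induction n as [|n IH]; intros H.
  - apply stable_true; intros; lia.
  - apply (stable_mono _ _ _ (fun Y => (forall i, (i < n)%nat -> Q i Y) /\ Q n Y)).
    + intros Y [A B] i Hi; destruct (Nat.eq_dec i n) as [->|]; [exact B|apply A; lia].
    + apply stable_and; [apply IH; auto|apply H; lia].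
Qed.

(** At [p + delta * d] the functional equals [f + delta * g]: either [f] already exceeds [kappa], or
    the tie is broken by [g > 0]. *)
Lemma stable_lin N p d a b e kappa : (a < N)%nat -> (b < N)%nat ->
  kappa < dot (vsub (p b) (p a)) e \/
  (dot (vsub (p b) (p a)) e = kappa /\ 0 < dot (vsub (d b) (d a)) e) ->
  stable N p d (fun Y => kappa < dot (vsub (Y b) (Y a)) e).
Proof.
  intros Ha Hb H.
  set (f := dot (vsub (p b) (p a)) e) in *; set (g := dot (vsub (d b) (d a)) e) in *.
  assert (Hd : exists d0, 0 < d0 /\ forall delta, 0 < delta < d0 -> kappa < f + delta * g).
  { destruct H as [H|[H Hg]].
    - pose proof (Rabs_pos g) as A.
      exists ((f - kappa) / (1 + Rabs g)); split; [apply Rdiv_lt_0_compat; lra|].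
      intros delta D.
      assert (delta * (1 + Rabs g) < f - kappa).
      { replace (f - kappa) with ((f - kappa) / (1 + Rabs g) * (1 + Rabs g)) by (field; lra).
        apply Rmult_lt_compat_r; lra. }
      pose proof (Rle_abs (- g)) as B; rewrite Rabs_Ropp in B; nra.
    - exists 1; split; [lra|]; intros delta D; nra. }
  destruct Hd as [d0 [H0 Hd]]; exists d0; split; [exact H0|]; intros delta D.
  specialize (Hd delta D).
  set (M := Rabs (fst e) + Rabs (snd e)).
  pose proof (Rabs_pos (fst e)); pose proof (Rabs_pos (snd e)).
  set (s := f + delta * g - kappa).
  (* Each of the two points may change the functional by less than half of the slack [s]. *)
  exists (s / (2 * (1 + M))); split; [unfold s, M; apply Rdiv_lt_0_compat; lra|].
  intros Y HY; destruct (HY a Ha) as [A1 A2]; destruct (HY b Hb) as [B1 B2].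
  simpl fst in *; simpl snd in *.
  pose proof (bilinear_bound _ _ (fst e) (snd e) M _ A1 A2 ltac:(unfold M; lra)) as A.
  pose proof (bilinear_bound _ _ (fst e) (snd e) M _ B1 B2 ltac:(unfold M; lra)) as B.
  apply (Rle_trans _ _ _ (Rle_abs _)) in A; rewrite <- Rabs_Ropp in B.
  apply (Rle_trans _ _ _ (Rle_abs _)) in B.
  assert (E : s / (2 * (1 + M)) * M < s / 2).
  { apply (Rmult_lt_reg_r (2 * (1 + M))); [unfold M; lra|].
    replace (s / (2 * (1 + M)) * M * (2 * (1 + M))) with (s * M) by (field; unfold M; lra).
    unfold s, M in *; nra. }
  replace (dot (vsub (Y b) (Y a)) e) with
    (f + delta * g +
     ((fst (Y b) - (fst (p b) + delta * fst (d b))) * fst e +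
      (snd (Y b) - (snd (p b) + delta * snd (d b))) * snd e) -
     ((fst (Y a) - (fst (p a) + delta * fst (d a))) * fst e +
      (snd (Y a) - (snd (p a) + delta * snd (d a))) * snd e))
    by (unfold f, g, dot, vsub; simpl; ring).
  assert (Es : s = f + delta * g - kappa) by reflexivity.
  set (X := s / (2 * (1 + M)) * M) in *; clearbody X s; lra.
Qed.

(** * Soundness of the certificates *)

(** [sin phi / (1 + cos phi)] is [tan (phi / 2)]. *)
Lemma half_angle_witness phi : 0 < phi < PI ->
  half_angle phi (17 / 2 * (sin phi / (1 + cos phi))).
Proof.
  intros H; assert (Hc : 0 < 1 + cos phi).
  { pose proof (cos_decreasing_1 phi PI) as B; rewrite cos_PI in B; lra. }
  pose proof (sin2_cos2 phi) as E; unfold Rsqr in E.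
  set (c := cos phi) in *; set (s := sin phi) in *.
  assert (Et : 4 * (17 / 2 * (s / (1 + c))) ^ 2 = 289 * (1 - c) / (1 + c)).
  { replace (4 * (17 / 2 * (s / (1 + c))) ^ 2) with (289 * (s * s) / ((1 + c) * (1 + c)))
      by (field; lra).
    replace (s * s) with ((1 - c) * (1 + c)) by lra; field; lra. }
  unfold half_angle; fold c s; rewrite Et; split.
  - field; lra.
  - field; lra.
Qed.

(** The Taylor bound [1 - x^2 / 2 + x^4 / 24] on [cos x] is negative at [x = 81 / 50], so
    [PI / 2 < 81 / 50]. *)
Lemma PI_upper : PI < 81 / 25.
Proof.
  apply Rnot_le_lt; intros H.
  assert (Hr : - PI / 2 <= 81 / 50 <= PI / 2) by lra.
  destruct (cos_bound (81 / 50) 0 ltac:(lra) ltac:(lra)) as [_ B].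
  assert (0 <= cos (81 / 50)) by (apply cos_ge_0; lra).
  unfold cos_approx, cos_term in B; simpl in B; lra.
Qed.

(** Here [phi <= 0.232], so [17 / 2 * sin phi < 1.972], while
    [1 + cos phi > 2 - phi^2 / 2 > 1.973]. *)
Lemma half_angle_le_1 phi : 0 < phi <= PI / 14 ->
  0 < 17 / 2 * (sin phi / (1 + cos phi)) <= 1.
Proof.
  intros H; pose proof PI_upper as HP.
  assert (Hs : 0 < sin phi) by (apply sin_gt_0; lra).
  assert (Hs' : sin phi < phi) by (apply sin_lt_x; lra).
  assert (Hh : 0 < sin (phi / 2)) by (apply sin_gt_0; lra).
  assert (Hh' : sin (phi / 2) < phi / 2) by (apply sin_lt_x; lra).
  assert (Hc : cos phi = 1 - 2 * sin (phi / 2) * sin (phi / 2)).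
  { rewrite <- cos_2a_sin; f_equal; lra. }
  assert (Hc' : 1 - phi * phi / 2 < cos phi) by (rewrite Hc; nra).
  assert (Hp : phi <= 0.232) by lra.
  assert (H1 : 0 < 1 + cos phi) by nra.
  split.
  - apply Rmult_lt_0_compat; [lra|apply Rdiv_lt_0_compat; lra].
  - apply (Rmult_le_reg_r (1 + cos phi)); [exact H1|].
    replace (17 / 2 * (sin phi / (1 + cos phi)) * (1 + cos phi)) with (17 / 2 * sin phi)
      by (field; lra).
    nra.
Qed.

Section Configuration.

Variables (phi t : R).
Hypothesis half : half_angle phi t.
Hypothesis t_range : 0 < t <= 1.

Let P (i : nat) : pt := tveval t (nd_pos (nd nodes i)).
Let D (i : nat) : pt := tveval t (nd_drift (nd nodes i)).
Let S (i : nat) : R := teval t (nd_pot (nd nodes i)).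

(** Point [r] lies in the same open cone of [i] as [j] and projects strictly closer, written as
    strict linear inequalities so that it survives small moves. *)
Definition blocked (Y : nat -> pt) (i j : nat) : Prop :=
  exists q n r, (r < 18)%nat /\ ((n - 3 - Z.of_nat q) mod 4 = 0)%Z /\
    0 < dot (vsub (Y j) (Y i)) (dir phi (q + 3) (n + 2)) /\
    0 < dot (vsub (Y j) (Y i)) (dir phi (q + 1) (n - 2)) /\
    0 < dot (vsub (Y r) (Y i)) (dir phi (q + 3) (n + 2)) /\
    0 < dot (vsub (Y r) (Y i)) (dir phi (q + 1) (n - 2)) /\
    0 < dot (vsub (Y j) (Y r)) (dir phi q n).

Lemma lex_pos_sound i j q n : (i < 18)%nat -> (j < 18)%nat ->
  lex_pos (nd nodes i) (nd nodes j) (tdir q n) = true ->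
  stable 18 P D (fun Y => 0 < dot (vsub (Y j) (Y i)) (dir phi q n)).
Proof.
  intros Hi Hj H; apply stable_lin; [exact Hi|exact Hj|].
  rewrite <- (tveval_dir phi t q n half).
  unfold P, D; rewrite <- !tveval_sub, <- !teval_dot.
  apply orb_prop in H; destruct H as [H|H].
  - left; apply tpos_sound; assumption.
  - apply andb_prop in H; destruct H as [H0 H1].
    right; split; [apply tzero_sound|apply tpos_sound]; assumption.
Qed.

Lemma check_blocked_sound i j q n r : (i < 18)%nat -> (j < 18)%nat ->
  check_blocked nodes i j q n r = true -> stable 18 P D (fun Y => blocked Y i j).
Proof.
  intros Hi Hj H; unfold check_blocked in H; cbv zeta in H.
  apply andb_prop in H; destruct H as [H H7].
  apply andb_prop in H; destruct H as [H H6].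
  apply andb_prop in H; destruct H as [H H5].
  apply andb_prop in H; destruct H as [H H4].
  apply andb_prop in H; destruct H as [H H3].
  apply andb_prop in H; destruct H as [H1 H2].
  apply Nat.ltb_lt in H1; apply Z.eqb_eq in H2.
  apply (stable_mono _ _ _ (fun Y =>
    0 < dot (vsub (Y j) (Y i)) (dir phi (q + 3) (n + 2)) /\
    0 < dot (vsub (Y j) (Y i)) (dir phi (q + 1) (n - 2)) /\
    0 < dot (vsub (Y r) (Y i)) (dir phi (q + 3) (n + 2)) /\
    0 < dot (vsub (Y r) (Y i)) (dir phi (q + 1) (n - 2)) /\
    0 < dot (vsub (Y j) (Y r)) (dir phi q n))).
  - intros Y HY; exists q, n, r; auto.
  - repeat apply stable_and; apply lex_pos_sound; assumption.
Qed.

(** [S] is the potential in the limit position; a factor [rho < 1] absorbs the displacement where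
    the bound is tight there. *)
Definition separated (rho : R) (Y : nat -> pt) (i j : nat) : Prop :=
  rho * Rabs (S j - S i) <= edist (Y j) (Y i) \/ (blocked Y j i /\ blocked Y i j).

Lemma check_pair_sound rho i j c : 0 <= rho < 1 -> (i < 18)%nat -> (j < 18)%nat ->
  check_pair nodes i j c = true -> stable 18 P D (fun Y => separated rho Y i j).
Proof.
  intros Hrho Hi Hj H; destruct c as [q n|q1 n1 r1 q2 n2 r2]; unfold check_pair in H.
  - cbv zeta in H; apply andb_prop in H; destruct H as [H H3].
    apply andb_prop in H; destruct H as [H1 H2].
    apply (tpos_sound t) in H1; [|exact t_range].
    apply (tnonneg_sound t) in H2; [|exact t_range].
    apply (tnonneg_sound t) in H3; [|exact t_range].
    rewrite teval_sub in H2; rewrite teval_add in H3.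
    rewrite teval_dot, tveval_sub, (tveval_dir phi t q n half) in H1, H2, H3.
    rewrite teval_sub in H2, H3.
    fold (P i) (P j) (S i) (S j) in H1, H2, H3.
    apply (stable_mono _ _ _ (fun Y =>
      rho * Rabs (S j - S i) < dot (vsub (Y j) (Y i)) (dir phi q n))).
    + intros Y HY; left.
      pose proof (dot_le_edist (Y j) (Y i) _ (dir_norm phi q n)); lra.
    + apply stable_lin; [exact Hi|exact Hj|left].
      assert (A : Rabs (S j - S i) <= dot (vsub (P j) (P i)) (dir phi q n))
        by (apply Rabs_le; lra).
      pose proof (Rabs_pos (S j - S i)); nra.
  - apply andb_prop in H; destruct H as [H1 H2].
    apply (stable_mono _ _ _ (fun Y => blocked Y j i /\ blocked Y i j)).
    + intros Y HY; right; exact HY.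
    + apply stable_and.
      * exact (check_blocked_sound j i _ _ _ Hj Hi H1).
      * exact (check_blocked_sound i j _ _ _ Hi Hj H2).
Qed.

Lemma all_separated rho : 0 <= rho < 1 ->
  stable 18 P D (fun Y => forall i, (i < 18)%nat -> forall j, (j < i)%nat ->
    separated rho Y i j).
Proof.
  intros Hrho; apply stable_forall; intros i Hi; apply stable_forall; intros j Hj.
  pose proof check_all_nodes as H; unfold check_all in H.
  rewrite forallb_forall in H; specialize (H i ltac:(apply in_seq; lia)).
  rewrite forallb_forall in H; specialize (H j ltac:(apply in_seq; lia)).
  eapply check_pair_sound; [exact Hrho|exact Hi|lia|exact H].
Qed.

Lemma teval_cos n : teval t (tcos n) = cos (IZR n * phi).
Proof. exact (f_equal fst (tveval_cis phi t n half)). Qed.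

Lemma teval_sin n : teval t (tsin n) = sin (IZR n * phi).
Proof. exact (f_equal snd (tveval_cis phi t n half)). Qed.

(** The denominator of the ratio is [4 cos^3 (2 phi)]; [len_uw] and [len_path] are [cos phi] times
    its denominator and numerator. *)
Lemma len_path_ratio : 0 < phi < PI / 4 ->
  teval t len_path = lower_bound_L (4 * phi) * teval t len_uw.
Proof.
  intros Hphi; unfold len_path, len_uw, len_uv1, tfour.
  repeat rewrite ?teval_add, ?teval_mul, ?teval_int, ?teval_cos, ?teval_sin.
  rewrite !Rmult_1_l.
  assert (HX : 0 < cos (2 * phi)) by (apply cos_gt_0; lra).
  unfold lower_bound_L.
  replace (4 * phi / 4) with phi by field; replace (3 * (4 * phi) / 4) with (3 * phi) by field.
  replace (4 * phi / 2) with (2 * phi) by field.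
  replace (3 * (4 * phi) / 2) with (3 * (2 * phi)) by field.
  replace (4 * phi) with (2 * (2 * phi)) by ring.
  assert (C3 : forall x, cos (3 * x) = 4 * cos x ^ 3 - 3 * cos x).
  { intros x; replace (3 * x) with (2 * x + x) by ring.
    rewrite cos_plus, cos_2a_cos, sin_2a.
    pose proof (sin2_cos2 x) as E; unfold Rsqr in E.
    transitivity ((2 * cos x * cos x - 1) * cos x - 2 * (sin x * sin x) * cos x); [ring|].
    replace (sin x * sin x) with (1 - cos x * cos x) by lra; ring. }
  assert (S3 : forall x, sin (3 * x) = sin x * (4 * cos x ^ 2 - 1)).
  { intros x; replace (3 * x) with (2 * x + x) by ring.
    rewrite sin_plus, cos_2a_cos, sin_2a; ring. }
  rewrite !C3, !S3, (sin_2a (2 * phi)).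
  replace (3 * cos (2 * phi) + (4 * cos (2 * phi) ^ 3 - 3 * cos (2 * phi)))
    with (4 * cos (2 * phi) ^ 3) by ring.
  set (X := cos (2 * phi)) in *; rewrite !sin_2a.
  assert (EX : X = 1 - 2 * sin phi ^ 2) by (unfold X; rewrite cos_2a_sin; ring).
  assert (EC : cos phi ^ 2 = 1 - sin phi ^ 2).
  { pose proof (sin2_cos2 phi) as E; unfold Rsqr in E; lra. }
  set (C := cos phi) in *; set (s := sin phi) in *.
  transitivity (C * (4 * C ^ 3 + 2 * s * C * (4 * X ^ 2 + 2 * X))); [|field; lra].
  transitivity (4 * C ^ 2 * (C ^ 2 + s * (2 * X ^ 2 + X))); [|ring].
  replace (C * C) with (C ^ 2) by ring; rewrite EC.
  rewrite EX; ring.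
Qed.

(** [Y j] is interior to its cone, so by [cone_unique] the edge can only come from that cone, where
    [Y r] contradicts minimality. *)
Lemma blocked_not_dedge k (V : list pt) Y i j : (1 <= k)%nat ->
  phi = cone_angle (4 * k + 3) / 4 -> (forall r, (r < 18)%nat -> In (Y r) V) ->
  blocked Y i j -> ~ theta_dedge (4 * k + 3) V (Y i) (Y j).
Proof.
  intros Hk Ephi HV [q [n [r [Hr [Hq [A1 [A2 [B1 [B2 C]]]]]]]]] [_ [_ [a [Ha [Hcone Hmin]]]]].
  destruct (bisector_dir k q n Hq) as [b [Hb Eb]]; rewrite <- Ephi in Eb.
  set (m := (4 * k + 3)%nat) in *.
  pose proof PI_RGT_0 as HP.
  assert (Hm : 7 <= INR m).
  { pose proof (le_INR 7 m ltac:(unfold m; lia)) as H7; simpl in H7; lra. }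
  assert (Hphi : 0 < phi /\ 2 * phi < PI / 2).
  { rewrite Ephi; unfold cone_angle; split.
    - apply Rdiv_lt_0_compat; [apply Rdiv_lt_0_compat|]; lra.
    - apply (Rmult_lt_reg_r (INR m)); [lra|].
      replace (2 * (2 * PI / INR m / 4) * INR m) with PI by (field; lra); nra. }
  destruct Hphi as [Hp0 Hp1].
  pose proof (inner_normals_cone phi q n (Y i) (Y j) Hp0 Hp1 A1 A2) as NA.
  pose proof (inner_normals_cone phi q n (Y i) (Y r) Hp0 Hp1 B1 B2) as NB.
  rewrite <- Eb in NA, NB, C.
  replace (2 * phi) with (cone_angle m / 2) in NA, NB by (rewrite Ephi; field).
  assert (Hab : b = a).
  { apply (cone_unique m b a (Y i) (Y j)); try assumption; [unfold m; lia|].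
    exact (proj1 Hcone). }
  subst a.
  assert (Hrc : in_cone m b (Y i) (Y r)).
  { split; [|lra]; intros E; rewrite E in B1.
    unfold dot, vsub in B1; rewrite !Rminus_diag in B1; simpl in B1; lra. }
  pose proof (Hmin (Y r) (HV r Hr) Hrc) as L.
  unfold dot, vsub in C, L; simpl in C, L; lra.
Qed.

End Configuration.

(** * Lengths of walks and the lower bound *)

(** Telescoping. The potential is a relation, so it need only be given on the vertices. *)
Lemma walk_potential (E : pt -> pt -> Prop) (V : pt -> R -> Prop) :
  (forall x y s, V x s -> E x y -> exists s', V y s' /\ s' - s <= edist x y) ->
  forall l u w s, V u s -> walk E u l w -> exists s', V w s' /\ s' - s <= walk_len u l.
Proof.
  intros HE l; induction l as [|x l IH]; intros u w s Hu Hl; simpl in *.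
  - subst w; exists s; split; [exact Hu|lra].
  - destruct Hl as [Hux Hl]; destruct (HE u x s Hu Hux) as [s1 [H1 D1]].
    destruct (IH x w s1 H1 Hl) as [s2 [H2 D2]]; exists s2; split; [exact H2|lra].
Qed.

Lemma edist_triangle p q r : edist p r <= edist p q + edist q r.
Proof.
  pose proof (triangle (fst p) (snd p) (fst r) (snd r) (fst q) (snd q)) as T.
  unfold dist_euc in T; unfold edist.
  rewrite !Rsqr_pow2 in T; exact T.
Qed.

Lemma edist_near eta p q : near eta p q -> edist p q <= 2 * eta.
Proof.
  intros [A B]; unfold edist.
  apply Rabs_def2 in A; apply Rabs_def2 in B.
  rewrite <- (sqrt_square (2 * eta)) by lra.
  apply sqrt_le_1_alt; nra.
Qed.

Lemma edist_perturb eta p q p' q' : near eta p p' -> near eta q q' ->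
  edist p' q' <= edist p q + 4 * eta.
Proof.
  intros A B; apply edist_near in A; apply edist_near in B.
  pose proof (edist_triangle p' p q'); pose proof (edist_triangle p q q').
  rewrite (edist_sym p' p) in *; lra.
Qed.

Lemma walk_len_nonneg l u : 0 <= walk_len u l.
Proof.
  revert u; induction l as [|x l IH]; intros u; simpl; [lra|].
  pose proof (edist_nonneg u x); pose proof (IH x); lra.
Qed.

(** Points 0 and 9, that is [u] and [w], have zero drift, so they move by less than [eta0] however
    [delta] is chosen. *)
Lemma perturbed_nodes m (P D : nat -> pt) (Q : (nat -> pt) -> Prop) eta0 : (0 < m)%nat ->
  0 < eta0 -> D 0%nat = (0, 0) -> D 9%nat = (0, 0) -> stable 18 P D Q ->
  exists V Y, general_position m V /\ length V = 18%nat /\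
    (forall i, (i < 18)%nat -> Y i = nth i V (0, 0)) /\
    near eta0 (P 0%nat) (Y 0%nat) /\ near eta0 (P 9%nat) (Y 9%nat) /\ Q Y.
Proof.
  intros Hm H0 D0 D9 [d0 [Hd0 Hd]].
  destruct (Hd (d0 / 2) ltac:(lra)) as [eta [He HQ]].
  set (X := fun i => (fst (P i) + d0 / 2 * fst (D i), snd (P i) + d0 / 2 * snd (D i))) in *.
  destruct (general_position_near m (map X (seq 0 18)) (Rmin eta eta0) Hm)
    as [V [HV HG]]; [apply Rmin_pos; assumption|].
  assert (HY : forall i, (i < 18)%nat -> near (Rmin eta eta0) (X i) (nth i V (0, 0))).
  { assert (G : forall l1 l2, Forall2 (near (Rmin eta eta0)) l1 l2 -> forall i,
      (i < length l1)%nat -> near (Rmin eta eta0) (nth i l1 (X 0%nat)) (nth i l2 (0, 0))).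
    { induction 1 as [|a b l1 l2 Hab _ IH]; intros i Hi; simpl in Hi; [lia|].
      destruct i; simpl; [exact Hab|apply IH; lia]. }
    intros i Hi; specialize (G _ _ HV i); rewrite length_map, length_seq in G.
    rewrite map_nth, seq_nth in G by exact Hi; exact (G Hi). }
  exists V, (fun i => nth i V (0, 0)); split; [exact HG|].
  split; [rewrite <- (Forall2_length HV), length_map, length_seq; reflexivity|].
  assert (HX : forall i, D i = (0, 0) -> X i = P i).
  { intros i E; unfold X; rewrite E; simpl; rewrite !Rmult_0_r, !Rplus_0_r.
    symmetry; apply surjective_pairing. }
  split; [auto|split; [|split]].
  - rewrite <- (HX 0%nat D0); apply (near_mono (Rmin eta eta0)); [apply Rmin_r|apply HY; lia].
  - rewrite <- (HX 9%nat D9); apply (near_mono (Rmin eta eta0)); [apply Rmin_r|apply HY; lia].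
  - apply HQ; intros i Hi; apply (near_mono (Rmin eta eta0)); [apply Rmin_l|apply HY; exact Hi].
Qed.

Lemma tveval_zero t : tveval t (tint 0, tint 0) = (0, 0).
Proof. unfold tveval; simpl; rewrite teval_int; reflexivity. Qed.

Theorem mainTheorem15 :
  forall (k : nat), (1 <= k)%nat ->
  forall eps : R, eps > 0 ->
  exists (P : list pt) (u w : pt),
    general_position (4 * k + 3) P /\ In u P /\ In w P /\ u <> w /\
    (exists l, walk (theta_edge (4 * k + 3) P) u l w) /\
    (forall l, walk (theta_edge (4 * k + 3) P) u l w ->
       walk_len u l >= (lower_bound_L (cone_angle (4 * k + 3)) - eps) * edist u w).
Proof.
  intros k Hk eps Heps.
  set (m := (4 * k + 3)%nat) in *.
  pose proof PI_RGT_0 as HP.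
  assert (Hm : 7 <= INR m).
  { pose proof (le_INR 7 m ltac:(unfold m; lia)) as H7; simpl in H7; lra. }
  set (phi := cone_angle m / 4).
  assert (Hphi : 0 < phi <= PI / 14).
  { unfold phi, cone_angle; split.
    - apply Rdiv_lt_0_compat; [apply Rdiv_lt_0_compat|]; lra.
    - apply (Rmult_le_reg_r (INR m)); [lra|].
      replace (2 * PI / INR m / 4 * INR m) with (PI / 2) by (field; lra); nra. }
  pose proof (half_angle_witness phi ltac:(lra)) as Hhalf.
  pose proof (half_angle_le_1 phi Hphi) as Ht.
  set (t := 17 / 2 * (sin phi / (1 + cos phi))) in *; clearbody t.
  set (p := fun i => tveval t (nd_pos (nd nodes i))).
  set (d := fun i => tveval t (nd_drift (nd nodes i))).
  set (s := fun i => teval t (nd_pot (nd nodes i))).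
  pose proof (tpos_sound t _ len_uw_tpos Ht) as HK.
  pose proof (tpos_sound t _ len_path_tpos Ht) as HL.
  pose proof (len_path_ratio phi t Hhalf ltac:(lra)) as EL.
  replace (4 * phi) with (cone_angle m) in EL by (unfold phi; field).
  set (L := lower_bound_L (cone_angle m)) in *.
  assert (s0 : s 0%nat = 0) by (unfold s; rewrite nodes_u; apply teval_int).
  assert (s9 : s 9%nat = teval t len_path).
  { unfold s; rewrite nodes_w; unfold nd_pot; simpl snd; rewrite teval_sub, teval_int; ring. }
  set (K := teval t len_uw) in *; set (Lam := teval t len_path) in *.
  assert (HLpos : 0 < L) by nra.
  assert (p0 : p 0%nat = (0, 0)) by (unfold p; rewrite nodes_u; apply tveval_zero).
  assert (d0 : d 0%nat = (0, 0)) by (unfold d; rewrite nodes_u; apply tveval_zero).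
  assert (d9 : d 9%nat = (0, 0)) by (unfold d; rewrite nodes_w; apply tveval_zero).
  assert (p9 : edist (p 0%nat) (p 9%nat) = K).
  { rewrite p0; unfold p; rewrite nodes_w; unfold nd_pos; simpl fst.
    change (walk_steps []) with (tint 0, tint 0).
    pose proof (dir_norm phi 1 (-1)) as N.
    rewrite <- (tveval_dir phi t 1 (-1) Hhalf) in N; revert N.
    generalize (tdir 1 (-1)); intros [a b] N.
    unfold dot, tveval in N; unfold tveval, tvadd, tvscale, edist; simpl fst in *; simpl snd in *.
    rewrite !teval_add, !teval_mul, !teval_int; fold K.
    transitivity (sqrt (K * K)); [f_equal|apply sqrt_square; lra].
    transitivity (K * K * (teval t a * teval t a + teval t b * teval t b));
      [ring|rewrite N; ring]. }
  (* The factor [1 - e1] on the potentials costs at most [eps / 2] in the ratio. *)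
  set (e1 := Rmin (1 / 2) (eps / (2 * L))).
  assert (He1 : 0 < e1 <= 1 / 2).
  { split; [apply Rmin_pos; [lra|apply Rdiv_lt_0_compat; lra]|apply Rmin_l]. }
  assert (He1' : e1 * L <= eps / 2).
  { replace (eps / 2) with (eps / (2 * L) * L) by (field; lra).
    apply Rmult_le_compat_r; [lra|apply Rmin_r]. }
  (* Moving [u] and [w] lengthens [|u w|] by at most [4 * eta0], which costs the other half of
     [eps]. *)
  set (eta0 := eps * K / (8 * L)).
  assert (Heta0 : 0 < eta0) by (apply Rdiv_lt_0_compat; nra).
  assert (Heta0' : 4 * eta0 * L = eps * K / 2) by (unfold eta0; field; lra).
  destruct (perturbed_nodes m p d _ eta0 ltac:(unfold m; lia) Heta0 d0 d9
    (all_separated phi t Hhalf Ht (1 - e1) ltac:(lra)))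
    as [V [Y [HG [HlenV [HY [N0 [N9 Hsep]]]]]]].
  assert (HV : forall r, (r < 18)%nat -> In (Y r) V).
  { intros r Hr; rewrite (HY r Hr); apply nth_In; lia. }
  assert (Hinj : forall i j, (i < 18)%nat -> (j < 18)%nat -> Y i = Y j -> i = j).
  { intros i j Hi Hj E; rewrite (HY i Hi), (HY j Hj) in E.
    apply (proj1 (NoDup_nth V (0, 0)) (proj1 HG)); [lia|lia|exact E]. }
  assert (Hedge : forall i j, (i < 18)%nat -> (j < 18)%nat -> theta_edge m V (Y i) (Y j) ->
    (1 - e1) * Rabs (s j - s i) <= edist (Y i) (Y j)).
  { assert (G : forall i j, (i < 18)%nat -> (j < i)%nat ->
      theta_edge m V (Y i) (Y j) \/ theta_edge m V (Y j) (Y i) ->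
      (1 - e1) * Rabs (s j - s i) <= edist (Y j) (Y i)).
    { intros i j Hi Hj E; destruct (Hsep i Hi j Hj) as [H|[B1 B2]]; [exact H|exfalso].
      pose proof (blocked_not_dedge phi k V Y j i Hk eq_refl HV B1).
      pose proof (blocked_not_dedge phi k V Y i j Hk eq_refl HV B2).
      unfold theta_edge, m in E; tauto. }
    intros i j Hi Hj E; destruct (lt_eq_lt_dec i j) as [[H| ->]|H].
    - rewrite <- Rabs_Ropp, Ropp_minus_distr; apply (G j i Hj H); right; exact E.
    - rewrite Rminus_diag, Rabs_R0, Rmult_0_r; apply edist_nonneg.
    - rewrite edist_sym; apply (G i j Hi H); left; exact E. }
  exists V, (Y 0%nat), (Y 9%nat).
  split; [exact HG|split; [apply HV; lia|split; [apply HV; lia|split; [|split]]]].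
  - intros E; apply Hinj in E; lia.
  - apply theta_connected; [unfold m; lia|apply HV; lia|apply HV; lia].
  - intros l Hl.
    destruct (walk_potential (theta_edge m V)
      (fun x r => exists i, (i < 18)%nat /\ x = Y i /\ r = (1 - e1) * s i)) with
      (l := l) (u := Y 0%nat) (w := Y 9%nat) (s := (1 - e1) * s 0%nat)
      as [r [[i [Hi [Ei ->]]] Hr]].
    + intros x y r [i [Hi [-> ->]]] E.
      assert (Hy : In y V) by (destruct E as [[_ [H _]]|[H _]]; exact H).
      destruct (In_nth V y (0, 0) Hy) as [j [Hj Ej]]; rewrite HlenV in Hj.
      rewrite <- (HY j Hj) in Ej; subst y.
      exists ((1 - e1) * s j); split; [exists j; auto|].
      pose proof (Hedge i j Hi Hj E) as B; pose proof (Rle_abs (s j - s i)); nra.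
    + exists 0%nat; split; [lia|auto].
    + exact Hl.
    + apply Hinj in Ei; [|lia|exact Hi]; subst i; rewrite s0, s9, EL in Hr.
      pose proof (edist_perturb eta0 _ _ _ _ N0 N9) as B; rewrite p9 in B.
      pose proof (edist_nonneg (Y 0%nat) (Y 9%nat)) as B0.
      destruct (Rle_dec (L - eps) 0) as [Hneg|Hpos].
      * pose proof (walk_len_nonneg l (Y 0%nat)); nra.
      (* The walk has length at least [(1 - e1) L K >= (L - eps / 2) K], and [(L - eps)(K + 4 eta0)]
         is at most that. *)
      * assert ((L - eps) * edist (Y 0%nat) (Y 9%nat) <= (L - eps) * (K + 4 * eta0))
          by (apply Rmult_le_compat_l; lra).
        nra.
Qed.
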